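(* Let $\Omega=[0,1]^3$ and, for $n\in\mathbb{Z}^3$, $m\in\{0,1\}^3$ and $y\in\Omega$, let $$y_{n,m}=\bigl((-1)^{m_1}y_1+2n_1,\ (-1)^{m_2}y_2+2n_2,\ (-1)^{m_3}y_3+2n_3\bigr),\qquad \Phi(z)=\frac{1}{4\pi|z|}.$$ Consider the decomposition $G^{\square}=G^{\square}_{27}+R^{\square}_{27}$ of the Dirichlet Green's function of the unit cube, where $$G^{\square}(x,y)=\sum_{n\in\mathbb{Z}^3}\ \sum_{m\in\{0,1\}^3}(-1)^{m_1+m_2+m_3}\,\Phi(x-y_{n,m}),$$ $$G^{\square}_{27}(x,y)=\sum_{n\in\{-1,0,1\}^3}\ \sum_{m\in\{0,1\}^3}(-1)^{m_1+m_2+m_3}\,\Phi(x-y_{n,m}),$$ and $R^{\square}_{27}$ is the remainder of the series. Then, for every $y\in\Omega$, the function $R^{\square}_{27}(\cdot,y)$ is harmonic in the enlarged domain $(-1,2)^3$. Consequently, for boundary data $f\in L^2(\partial\Omega)$, the function $$H_R(x)=\int_{\partial\Omega}\frac{\partial R^{\square}_{27}}{\partial n_y}(x,y)\,f(y)\,dS_y$$ is harmonic in $(-1,2)^3$.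
   Context: Here $|\cdot|$ is the Euclidean norm on $\mathbb{R}^3$, $n_y$ is the outward unit normal to $\partial\Omega$ at $y$ (defined off the edges of the cube, hence almost everywhere), $\partial/\partial n_y$ is differentiation with respect to the second variable $y$ in that direction, and $dS_y$ is surface measure on $\partial\Omega$. The lattice series is only conditionally convergent as a series of individual source terms; it is summed in the order written: for each $n\in\mathbb{Z}^3$ the finite inner sum over $m\in\{0,1\}^3$ is taken first, and these grouped terms are then summed over $n$. The remainder $R^{\square}_{27}(x,y)$ consists precisely of the terms with $n\notin\{-1,0,1\}^3$: $$R^{\square}_{27}(x,y)=\sum_{n\in\mathbb{Z}^3\setminus\{-1,0,1\}^3}\ \sum_{m\in\{0,1\}^3}(-1)^{m_1+m_2+m_3}\,\Phi(x-y_{n,m}).$$ This formula is used to define $R^{\square}_{27}(x,y)$ for all $x\in(-1,2)^3$, including points at which $G^{\square}$ and $G^{\square}_{27}$ are singular. The same formula is used for $y$ in a neighborhood of $\Omega$, so that normal derivatives at $y\in\partial\Omega$ make sense. *)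

(* Defs.v *)
From HB Require Import structures.
From mathcomp Require Import all_boot all_order all_algebra.
From mathcomp Require Import all_classical all_reals all_analysis.
From mathcomp Require summability.
Export numFieldNormedType.Exports.

Set Implicit Arguments.
Unset Strict Implicit.
Unset Printing Implicit Defensive.

Import Order.TTheory GRing.Theory Num.Theory.

Local Open Scope classical_set_scope.
Local Open Scope ring_scope.

Section harmonic.
Context {R : realType}.

(* The norm of the normed module 'rV[R]_3 in the library is the sup norm: it
   gives the same topology and directional derivatives, but it is not |.|. *)
Definition enorm (z : 'rV[R]_3) : R := Num.sqrt (\sum_i z 0 i ^+ 2).

Definition partial (i : 'I_3) (u : 'rV[R]_3 -> R) : 'rV[R]_3 -> R :=
  'D_(delta_mx 0 i) u.

Definition C1_on (U : set 'rV[R]_3) (u : 'rV[R]_3 -> R) : Prop :=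
  forall i x, U x ->
    derivable u x (delta_mx 0 i) /\ {for x, continuous (partial i u)}.

Definition C2_on (U : set 'rV[R]_3) (u : 'rV[R]_3 -> R) : Prop :=
  C1_on U u /\ forall i, C1_on U (partial i u).

Definition laplacian (u : 'rV[R]_3 -> R) (x : 'rV[R]_3) : R :=
  \sum_i partial i (partial i u) x.

(* Meant for an open set U. *)
Definition harmonic_on (U : set 'rV[R]_3) (u : 'rV[R]_3 -> R) : Prop :=
  C2_on U u /\ forall x, U x -> laplacian u x = 0.

End harmonic.

Section green_cube.
Context {R : realType}.

Definition cube : set 'rV[R]_3 := [set x | forall i, 0 <= x 0 i <= 1].

Definition enlarged_cube : set 'rV[R]_3 := [set x | forall i, -1 < x 0 i < 2].

Definition cube_boundary : set 'rV[R]_3 :=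
  cube `&` [set x | exists i, x 0 i = 0 \/ x 0 i = 1].

(* Junk value Phi 0 = 0. *)
Definition Phi (z : 'rV[R]_3) : R := (4 * pi * enorm z)^-1.

Definition image_point (y : 'rV[R]_3) (n : {ffun 'I_3 -> int})
    (m : {ffun 'I_3 -> bool}) : 'rV[R]_3 :=
  \row_i ((-1) ^+ m i * y 0 i + 2 * (n i)%:~R).

Definition green_term (x y : 'rV[R]_3) (n : {ffun 'I_3 -> int}) : R :=
  \sum_(m : {ffun 'I_3 -> bool})
    (-1) ^+ (\sum_i m i)%N * Phi (x - image_point y n m).

Definition box27 : set {ffun 'I_3 -> int} :=
  [set n | forall i, n i \in [:: -1; 0; 1]].

Definition remainder_term (x y : 'rV[R]_3) (n : {ffun 'I_3 -> int}) : R :=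
  if n \in box27 then 0 else green_term x y n.

(* Sums over the lattice are limits of the finite partial sums along the net
   of finite subsets, so that no enumeration of the lattice is chosen. *)
Definition lattice_cvg (a : {ffun 'I_3 -> int} -> R) : Prop :=
  cvg (summability.partial_sum a @ summability.totally).

Definition green (x y : 'rV[R]_3) : R := summability.sum (green_term x y).

Definition green27 (x y : 'rV[R]_3) : R :=
  \sum_(n \in box27) green_term x y n.

Definition green_remainder (x y : 'rV[R]_3) : R :=
  summability.sum (remainder_term x y).

(* Outward unit normal at a point of the boundary lying on a single face.  On
   the edges (a null set) the value is not a unit vector and is irrelevant. *)
Definition outward_normal (y : 'rV[R]_3) : 'rV[R]_3 :=
  \row_i ((y 0 i == 1)%:R - (y 0 i == 0)%:R).

(* Isometric chart of the face y_i = b: the two coordinates other than the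
   i-th one are given, in increasing order, by st. *)
Definition face (i : 'I_3) (b : bool) (st : R * R) : 'rV[R]_3 :=
  \row_j (if unlift i j is Some k then if k == ord0 then st.1 else st.2
          else b%:R).

Definition unit_square : set (measurableTypeR R * measurableTypeR R) :=
  `[0, 1]%classic `*` `[0, 1]%classic.

Local Notation lebesgue2 :=
  (@lebesgue_measure R \x @lebesgue_measure R)%E.

(* Integral for the surface measure of the boundary, i.e., the sum of the
   area measures of the six faces (which overlap on null sets only). *)
Definition boundary_integral (g : 'rV[R]_3 -> R) : R :=
  \sum_(i < 3) \sum_(b : bool) \int[lebesgue2]_(st in unit_square) g (face i b st).

Definition boundary_integrable (g : 'rV[R]_3 -> R) : Prop :=
  forall i b, lebesgue2.-integrable unit_square
    (fun st => (g (face i b st))%:E).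

(* Only the values of f on the boundary matter. *)
Definition boundary_L2 (f : 'rV[R]_3 -> R) : Prop :=
  forall i b, measurable_fun unit_square (fun st => f (face i b st)) /\
    (\int[lebesgue2]_(st in unit_square) (f (face i b st) ^+ 2)%:E < +oo)%E.

Definition poisson_integrand (f : 'rV[R]_3 -> R) (x y : 'rV[R]_3) : R :=
  'D_(outward_normal y) (green_remainder x) y * f y.

Definition remainder_potential (f : 'rV[R]_3 -> R) (x : 'rV[R]_3) : R :=
  boundary_integral (poisson_integrand f x).

End green_cube.

(* Main.v *)
(* Every term of the image series, and every one of its derivatives, is an
   alternating sum over the eight reflections of a function of x - y_{n,m} that
   lies in the algebra generated by the z_i / |z| and 1 / |z|, graded by the
   order of decay.  Differentiating in x raises this order by one.
   Differentiating in y_j also raises it by one, and toggles whether the sign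
   (-1)^{m_j} is present; each sign present is worth one more order, since the
   sum vanishes at y_j = 0, so that by the mean value theorem it is bounded by
   its y_j-derivative.  Hence the total order, four for the series itself, never
   drops, and the terms with n outside {-1,0,1}^3, whose image points stay away
   from (-1,2)^3, are O(|n|^-4) with all their derivatives, which is summable
   over Z^3.  Second-order Taylor estimates with these constants then pass to
   the sum over n, and to the integral against f over the six faces. *)

Require Import Defs.
From mathcomp Require Import all_boot all_order all_algebra.
From mathcomp Require Import all_classical all_reals all_analysis.
From mathcomp Require Import finmap summability measurable_realfun.
From mathcomp Require Import ring lra zify.
Set Implicit Arguments.
Unset Strict Implicit.
Unset Printing Implicit Defensive.
Import Order.TTheory GRing.Theory Num.Theory.
Local Open Scope classical_set_scope.
Local Open Scope ring_scope.

(** * Homogeneous functions of the distance *)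

Section symbols.
Context {R : realType}.
Implicit Types (z h x y : 'rV[R]_3) (t : R) (i j : 'I_3).

(* Formal expressions in the constants, the z_i / |z| and 1 / |z|; [ev]
   interprets them at z, [dsym j] is d/dz_j and [symdeg] the order of decay. *)
Inductive sym := Cst of R | Dir of 'I_3 | Rho | Add of sym & sym
  | Mul of sym & sym.

Fixpoint ev (u : sym) z : R :=
  match u with
  | Cst c => c
  | Dir i => z 0 i / enorm z
  | Rho => (enorm z)^-1
  | Add a b => ev a z + ev b z
  | Mul a b => ev a z * ev b z
  end.

(** The derivative of a constant is kept as 0 times 1 / |z| and nothing is simplified, so that
    differentiation raises [symdeg] by exactly one on every expression. *)
Fixpoint dsym j (u : sym) : sym :=
  match u with
  | Cst c => Mul (Cst 0) Rho
  | Dir i => Mul Rho (Add (Cst (i == j)%:R)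
                          (Mul (Cst (-1)) (Mul (Dir i) (Dir j))))
  | Rho => Mul (Cst (-1)) (Mul (Dir j) (Mul Rho Rho))
  | Add a b => Add (dsym j a) (dsym j b)
  | Mul a b => Add (Mul (dsym j a) b) (Mul a (dsym j b))
  end.

Fixpoint symdeg (u : sym) : nat :=
  match u with
  | Cst _ => 0
  | Dir _ => 0
  | Rho => 1
  | Add a b => minn (symdeg a) (symdeg b)
  | Mul a b => symdeg a + symdeg b
  end.

Lemma symdeg_dsym j u : symdeg (dsym j u) = (symdeg u).+1.
Proof. by elim: u => //= a -> b ->; rewrite ?minnSS// addSn addnS minnn. Qed.

Lemma enorm_ge0 z : 0 <= enorm z. Proof. exact: sqrtr_ge0. Qed.

Lemma sqr_enorm z : enorm z ^+ 2 = \sum_i z 0 i ^+ 2.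
Proof. by rewrite sqr_sqrtr// sumr_ge0// => i _; rewrite sqr_ge0. Qed.

Lemma coord_le_enorm z i : `|z 0 i| <= enorm z.
Proof.
rewrite -sqrtr_sqr ler_wsqrtr// (bigD1 i)//= lerDl sumr_ge0// => j _.
exact: sqr_ge0.
Qed.

Lemma dir_le1 z i : `|z 0 i / enorm z| <= 1.
Proof.
have [->|z0] := eqVneq (enorm z) 0; first by rewrite invr0 mulr0 normr0.
rewrite normrM normfV (ger0_norm (enorm_ge0 z)) ler_pdivrMr ?mul1r.
  exact: coord_le_enorm.
by rewrite lt_neqAle eq_sym z0 enorm_ge0.
Qed.

(** A sum decays only like its slowest summand; a faster summand is brought down to that order by
    bounding its surplus powers of 1 / |z| by powers of [A]. *)
Lemma ev_bound u (A : R) : 0 <= A ->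
  exists2 C : R, 0 <= C & forall z, (enorm z)^-1 <= A ->
    `|ev u z| <= C * (enorm z)^-1 ^+ symdeg u.
Proof.
move=> A0.
have r0 z : 0 <= (enorm z)^-1 by rewrite invr_ge0 enorm_ge0.
have lower (z : 'rV[R]_3) (k l : nat) : (enorm z)^-1 <= A -> (k <= l)%N ->
    (enorm z)^-1 ^+ l <= A ^+ (l - k) * (enorm z)^-1 ^+ k.
  move=> zA kl; rewrite -{1}(subnK kl) exprD ler_wpM2r ?exprn_ge0//.
  by rewrite lerXn2r ?nnegrE.
elim: u => [c|i||a [Ca Ca0 Ha] b [Cb Cb0 Hb]|a [Ca Ca0 Ha] b [Cb Cb0 Hb]] /=.
- by exists `|c| => // z _; rewrite expr0 mulr1.
- by exists 1 => // z _; rewrite expr0 mulr1 dir_le1.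
- by exists 1 => // z _; rewrite expr1 mul1r ger0_norm.
- set k := minn _ _.
  exists (Ca * A ^+ (symdeg a - k) + Cb * A ^+ (symdeg b - k)).
    by rewrite addr_ge0// mulr_ge0// exprn_ge0.
  move=> z zA; rewrite (le_trans (ler_normD _ _))// mulrDl lerD//.
    rewrite (le_trans (Ha z zA))// -mulrA ler_wpM2l// lower// geq_minl//.
  by rewrite (le_trans (Hb z zA))// -mulrA ler_wpM2l// lower// geq_minr.
- exists (Ca * Cb); first exact: mulr_ge0.
  by move=> z zA; rewrite normrM exprD mulrACA ler_pM// ?Ha ?Hb.
Qed.

Lemma is_derive_rho z h t : enorm (z + t *: h) != 0 ->
  is_derive t 1 (fun t => (enorm (z + t *: h))^-1)
   (- (\sum_j h 0 j * (z + t *: h) 0 j) * (enorm (z + t *: h))^-1 ^+ 3).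
Proof.
move=> zt0.
have pos : 0 < enorm (z + t *: h) by rewrite lt_neqAle eq_sym zt0 enorm_ge0.
have pos2 : 0 < \sum_i (z + t *: h) 0 i ^+ 2 by rewrite -sqr_enorm exprn_gt0.
have dcoord i : is_derive t 1 (fun s : R => (z + s *: h) 0 i) (h 0 i).
  rewrite (_ : (fun _ => _) = (fun s : R => z 0 i + s * h 0 i)); last first.
    by apply/funext => s; rewrite !mxE.
  by apply: is_derive_eq; rewrite /GRing.scale/=; ring.
have dsum : is_derive t 1 (fun s : R => \sum_i (z + s *: h) 0 i ^+ 2)
    (\sum_i 2 * h 0 i * (z + t *: h) 0 i).
  rewrite (_ : (fun _ => _) = \sum_i (fun s : R => (z + s *: h) 0 i ^+ 2));
    last by apply/funext => s; rewrite fct_sumE.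
  apply: is_derive_sum => i.
  have H := is_deriveX 2 (dcoord i).
  rewrite exprfctE in H.
  by apply: (is_derive_eq H); rewrite /GRing.scale/= expr1; ring.
have := @is_derive1_sqrt R _ pos2.
move=> dsq.
have dn : is_derive t 1 (fun s : R => enorm (z + s *: h))
   ((2 * enorm (z + t *: h))^-1 * \sum_i 2 * h 0 i * (z + t *: h) 0 i).
  exact: is_derive1_comp.
apply: (is_derive_eq (is_deriveV (f := fun s => enorm (z + s *: h)) zt0 dn)).
rewrite /GRing.scale/=.
under eq_bigr do rewrite -mulrA.
rewrite -mulr_sumr -exprVn.
by field; rewrite zt0.
Qed.

(** Derivatives along lines are enough, because the later estimates follow segments by the mean
    value theorem. *)
Lemma ev_derive u z h t : enorm (z + t *: h) != 0 ->
  is_derive t 1 (fun t => ev u (z + t *: h))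
    (\sum_j h 0 j * ev (dsym j u) (z + t *: h)).
Proof.
move=> zt0.
have dcoord i : is_derive t 1 (fun s : R => (z + s *: h) 0 i) (h 0 i).
  rewrite (_ : (fun _ => _) = (fun s : R => z 0 i + s * h 0 i)); last first.
    by apply/funext => s; rewrite !mxE.
  by apply: is_derive_eq; rewrite /GRing.scale/=; ring.
have drho := is_derive_rho zt0.
elim: u => [c|i||a Ha b Hb|a Ha b Hb] /=.
- apply: (is_derive_eq (is_derive_cst _ _ _)).
  by rewrite big1// => j _; rewrite mul0r mulr0.
- have := is_deriveM (dcoord i) drho.
  move=> H; apply: (is_derive_eq H).
  rewrite /GRing.scale/=.
  set w := z + t *: h; set r := (enorm w)^-1.
  transitivity (\sum_j (h 0 j * (i == j)%:R * r - w 0 i * r ^+ 3 *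
      (h 0 j * w 0 j))); last by apply: eq_bigr => j _; ring.
  have -> : \sum_j (h 0 j * (i == j)%:R * r - w 0 i * r ^+ 3 * (h 0 j * w 0 j))
      = h 0 i * r - w 0 i * r ^+ 3 * \sum_j h 0 j * w 0 j.
    rewrite sumrB -mulr_sumr; congr (_ - _).
    rewrite (bigD1 i)//= eqxx mulr1 big1 ?addr0// => j.
    by rewrite eq_sym => /negPf ->; rewrite mulr0 mul0r.
  by ring.
- apply: (is_derive_eq drho).
  rewrite mulNr mulr_suml -sumrN; apply: eq_bigr => j _.
  by field.
- apply: (is_derive_eq (is_deriveD Ha Hb)).
  by rewrite -big_split/=; apply: eq_bigr => j _; rewrite mulrDr.
- apply: (is_derive_eq (is_deriveM Ha Hb)).
  rewrite /GRing.scale/= !mulr_sumr -big_split/=; apply: eq_bigr => j _; ring.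
Qed.

Definition Phi_sym : sym := Mul (Cst (4 * pi)^-1) Rho.

Lemma ev_Phi z : ev Phi_sym z = Phi z.
Proof. by rewrite /= /Phi -invfM. Qed.

Lemma sum_sqr_dir z : enorm z != 0 -> \sum_i (z 0 i / enorm z) ^+ 2 = 1.
Proof.
move=> z0; rewrite (eq_bigr (fun i => z 0 i ^+ 2 / enorm z ^+ 2)); last first.
  by move=> i _; rewrite expr_div_n.
by rewrite -mulr_suml -sqr_enorm divff// expf_neq0.
Qed.

(** In terms of the direction cosines a, b, c and r = 1 / |z| this is a polynomial identity modulo
    a^2 + b^2 + c^2 = 1; eliminating a^2 leaves it to [ring]. *)
Lemma laplace_Phi z : enorm z != 0 ->
  \sum_i ev (dsym i (dsym i Phi_sym)) z = 0.
Proof.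
move=> /sum_sqr_dir; rewrite !big_ord_recl !big_ord0 /=.
set r := (enorm z)^-1.
move: (z 0 _ * r) (z 0 _ * r) (z 0 _ * r) => a b c H.
have {}H : a ^+ 2 = 1 - b ^+ 2 - c ^+ 2 by rewrite -H; ring.
ring: H.
Qed.

(** Derivatives of harmonic functions are harmonic, but moving [dsym j] to the outside changes the
    formal expression, so each j is computed directly modulo the same relation. *)
Lemma laplace_dsym_Phi j z : enorm z != 0 ->
  \sum_i ev (dsym i (dsym i (dsym j Phi_sym))) z = 0.
Proof.
move=> /sum_sqr_dir.
rewrite !big_ord_recl !big_ord0.
set i0 : 'I_3 := ord0; set i1 := lift i0 _; set i2 := lift i0 _.
have : [\/ j = i0, j = i1 | j = i2].
  case: j => -[|[|[|//]]] ?; [apply: Or31|apply: Or32|apply: Or33];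
    exact: val_inj.
rewrite /=.
set r := (enorm z)^-1.
case=> ->; rewrite /=;
move: (z 0 _ * r) (z 0 _ * r) (z 0 _ * r) => a b c H;
(have {}H : a ^+ 2 = 1 - b ^+ 2 - c ^+ 2 by rewrite -H; ring);
ring: H.
Qed.
End symbols.

(** * Lattice terms *)

Section lattice_terms.
Context {R : realType}.
Implicit Types (z h k x y : 'rV[R]_3) (t : R) (i j : 'I_3) (S : {set 'I_3})
  (n : {ffun 'I_3 -> int}) (m : {ffun 'I_3 -> bool}) (u : @sym R).

(** [S] records the coordinates y_j in which the sum over reflections is odd; it is even in the
    others. *)
Definition gsign S m : R := \prod_(i in S) (-1) ^+ m i.

(* A y_j-derivative brings down the factor (-1)^{m_j}. *)
Definition toggle j S : {set 'I_3} := if j \in S then S :\ j else j |: S.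

Lemma gsign_toggle j S m : gsign S m * (-1) ^+ m j = gsign (toggle j S) m.
Proof.
rewrite /gsign /toggle; case: ifPn => jS.
  by rewrite (big_setD1 j)//= mulrAC -signr_addb addbb mul1r.
by rewrite big_setU1//= mulrC.
Qed.

Lemma card_toggle j S : (#|S| <= #|toggle j S|.+1)%N.
Proof.
rewrite /toggle; case: ifPn => jS; first by rewrite (cardsD1 j S) jS.
by rewrite cardsU1 jS; lia.
Qed.

Definition lterm S u x y n : R :=
  \sum_m gsign S m * ev u (x - image_point y n m).

(** The differential in the joint direction (h, k). The minus sign comes from x - y_{n,m}, and the
    reflection factor (-1)^{m_j} is absorbed by [toggle]. *)
Definition dlterm S u h k x y n : R :=
  \sum_j (h 0 j * lterm S (dsym j u) x y n
          - k 0 j * lterm (toggle j S) (dsym j u) x y n).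

Lemma green_termE x y n :
  green_term x y n = lterm [set: 'I_3]%SET Phi_sym x y n.
Proof.
apply: eq_bigr => m _; rewrite ev_Phi; congr (_ * _).
by rewrite -prodrXr; apply: eq_bigl => i; rewrite finset.in_setT.
Qed.

(** For each m a line in (x, y) becomes a line in z, to which [ev_derive] applies. *)
Lemma image_point_affine x y h k n m t :
  x + t *: h - image_point (y + t *: k) n m =
  (x - image_point y n m) + t *: (h - \row_i ((-1) ^+ m i * k 0 i)).
Proof. by apply/rowP => i; rewrite !mxE; ring. Qed.

Lemma is_derive_bigsum (I : finType) (f : I -> R -> R) (df : I -> R) t :
  (forall a, is_derive t 1 (f a) (df a)) ->
  is_derive t 1 (fun s => \sum_a f a s) (\sum_a df a).
Proof.
move=> H; rewrite (_ : (fun _ => _) = \sum_a f a); last first.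
  by apply/funext => s; rewrite fct_sumE.
by elim/big_ind2 : _ => // [|] *; [exact: is_derive_cst|exact: is_deriveD].
Qed.

Lemma is_derive_mull (c : R) (f : R -> R) df t :
  is_derive t 1 f df -> is_derive t 1 (fun s => c * f s) (c * df).
Proof. by move=> H; have := is_deriveZ c H. Qed.

Lemma lterm_derive S u x y h k n t :
  (forall m, enorm (x + t *: h - image_point (y + t *: k) n m) != 0) ->
  is_derive t 1 (fun s => lterm S u (x + s *: h) (y + s *: k) n)
    (dlterm S u h k (x + t *: h) (y + t *: k) n).
Proof.
move=> Hm.
rewrite [X in is_derive _ _ _ X](_ : _ = \sum_m gsign S m *
  \sum_j (h 0 j - (-1) ^+ m j * k 0 j) *
    ev (dsym j u) (x + t *: h - image_point (y + t *: k) n m)).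
  apply: is_derive_bigsum => m; apply: is_derive_mull.
  rewrite (_ : (fun _ => _) = fun s => ev u ((x - image_point y n m) +
      s *: (h - \row_i ((-1) ^+ m i * k 0 i)))); last first.
    by apply/funext => s; rewrite image_point_affine.
  rewrite image_point_affine.
  apply: is_derive_eq.
    by apply: ev_derive; rewrite -image_point_affine.
  by apply: eq_bigr => j _; rewrite !mxE.
under [RHS]eq_bigr do rewrite mulr_sumr.
rewrite exchange_big; apply: eq_bigr => j _ /=.
rewrite /lterm !mulr_sumr -sumrB; apply: eq_bigr => m _.
by rewrite -gsign_toggle; ring.
Qed.

(** Flipping m_j fixes the image point when y_j = 0 and reverses [gsign], so the sum equals its own
    negative. *)
Lemma lterm_eq0 S u x y n j : j \in S -> y 0 j = 0 -> lterm S u x y n = 0.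
Proof.
move=> jS yj0.
pose fm m := [ffun i => if i == j then ~~ m i else m i] : {ffun 'I_3 -> bool}.
have fmK : involutive fm.
  move=> m; apply/ffunP => i; rewrite !ffunE.
  by case: eqP => // _; rewrite negbK.
have : lterm S u x y n = - lterm S u x y n.
  rewrite {1}/lterm (reindex_inj (inv_inj fmK)) /= -sumrN.
  apply: eq_bigr => m _; rewrite -mulNr; congr (_ * ev u (_ - _)).
    rewrite /gsign !(big_setD1 j jS)/= ffunE eqxx -mulNr; congr (_ * _).
      by case: (m j) => /=; rewrite ?expr0 ?expr1 ?opprK.
    apply: eq_bigr => i; rewrite !inE => /andP[/negPf ij _].
    by rewrite ffunE ij.
  apply/rowP => i; rewrite !mxE ffunE.
  by case: eqP => // ->; rewrite yj0 !mulr0.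
lra.
Qed.

(** The margin 1/4 leaves room for y-derivatives across the faces, and symmetry about 0 lets y_j be
    shrunk to 0 inside the set. *)
Definition near_cube : set 'rV[R]_3 := [set y | forall i, `|y 0 i| < 5 / 4].

Definition supn n : nat := \max_i `|n i|%N.

Lemma notin_box27 n : n \notin box27 -> (1 < supn n)%N.
Proof.
apply: contraR; rewrite -leqNgt => H; apply/mem_set => i.
have : (`|n i| <= 1)%N by apply: leq_trans H; exact: leq_bigmax.
rewrite !inE; lia.
Qed.

Lemma in_box27 n : n \in box27 -> (supn n <= 1)%N.
Proof.
move=> /set_mem H; apply/bigmax_leqP => i _.
have := H i; rewrite !inE; lia.
Qed.

(** In a coordinate where |n_i| = N is maximal the distance is at least 2 N - 5/4 - 2, which is at
    least 3/8 N exactly when N >= 2. *)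
Lemma enorm_lower x y n m : enlarged_cube x -> near_cube y ->
  n \notin box27 -> 3 / 8 * (supn n)%:R <= enorm (x - image_point y n m).
Proof.
move=> Ex Yy /notin_box27 n1.
have [|i Hi] := @bigop.eq_bigmax _ (fun i => `|n i|%N).
  by rewrite card_ord.
apply: le_trans (coord_le_enorm _ i); rewrite !mxE.
have /andP[x1 x2] := Ex i.
have : `|(-1) ^+ m i * y 0 i| < 5 / 4 by rewrite normrMsign; exact: Yy.
move: (_ * y 0 i) => v; rewrite ltr_norml => /andP[v1 v2].
move: n1; rewrite [supn n]Hi -(ler_nat R) => n1.
have : (`|n i|%:R = (n i)%:~R :> R) \/ (`|n i|%:R = - (n i)%:~R :> R).
  case: (n i) => l; [by left|right].
  by rewrite NegzE rmorphN/= opprK.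
rewrite ler_normr => -[|] E; apply/orP; [right|left]; rewrite E in n1 *; lra.
Qed.

End lattice_terms.

(** * Uniform decay, Lipschitz and Taylor estimates for the lattice terms *)

Lemma mean_value01 (R : realType) (f df : R -> R) :
  (forall t : R, 0 <= t <= 1 -> is_derive t 1 f (df t)) ->
  exists2 c, 0 <= c <= 1 & f 1 - f 0 = df c.
Proof.
move=> fdf.
have [|||c] := @MVT_segment R f df 0 1.
- exact: ler01.
- by move=> x; rewrite in_itv/= => /andP[x0 x1]; apply: fdf; rewrite !ltW.
- apply: continuous_in_subspaceT => x /set_mem/=; rewrite in_itv/= => x01.
  apply: differentiable_continuous; apply/derivable1_diffP.
  by case: (fdf x x01).
by rewrite in_itv/= => c01 ->; exists c => //; rewrite subr0 mulr1.
Qed.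

Lemma coord_le_norm (R : realType) n (h : 'rV[R]_n) i : `|h 0 i| <= `|h|.
Proof.
rewrite [leRHS]/Num.norm /= mx_normrE; apply/bigmax_geP; right => /=.
by exists (0, i).
Qed.

Section lattice_term_bounds.
Context {R : realType}.
Implicit Types (z h k x y : 'rV[R]_3) (t : R) (i j : 'I_3) (S : {set 'I_3})
  (n : {ffun 'I_3 -> int}) (m : {ffun 'I_3 -> bool}) (u : @sym R).

Lemma enorm_neq0 x y n m : enlarged_cube x -> near_cube y ->
  n \notin box27 -> enorm (x - image_point y n m) != 0.
Proof.
move=> Ex Yy nbox; have := enorm_lower m Ex Yy nbox.
move: (notin_box27 nbox); rewrite -(ltr_nat R) => n1 H.
by apply: lt0r_neq0; apply: lt_le_trans H; lra.
Qed.

Lemma rho_le x y n m : enlarged_cube x -> near_cube y ->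
  n \notin box27 ->
  (enorm (x - image_point y n m))^-1 <= 8 / 3 * (supn n)%:R^-1.
Proof.
move=> Ex Yy nbox; have H := enorm_lower m Ex Yy nbox.
have n1 := notin_box27 nbox; rewrite -(ltr_nat R) in n1.
have -> : 8 / 3 * (supn n)%:R^-1 = (3 / 8 * (supn n)%:R)^-1 :> R.
  by field; rewrite lt0r_neq0//; lra.
by rewrite lef_pV2 ?posrE//; [apply: lt_le_trans H; lra|lra].
Qed.

(* By induction on #|S|: for j in S the term vanishes at y_j = 0, and
   d/dy_j removes j from S. *)
Lemma lterm_bound S u : exists2 C : R, 0 <= C & forall x y n,
  enlarged_cube x -> near_cube y -> n \notin box27 ->
  `|lterm S u x y n| <= C * (supn n)%:R^-1 ^+ (symdeg u + #|S|).
Proof.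
move: {2}#|S| (erefl #|S|) => s; elim: s S u => [|s IH] S u Ss.
  (* Since [supn n] is at least 2, [rho_le] gives 1 / |z| <= 8/3 * 1/2 = 4/3. The factor 8 below
     counts the reflections. *)
  have [C C0 HC] := @ev_bound R u (4 / 3) ltac:(lra).
  exists (8 * (C * (8 / 3) ^+ symdeg u)).
    by rewrite mulr_ge0// mulr_ge0// exprn_ge0//; lra.
  move=> x y n Ex Yy nbox; rewrite Ss addn0.
  rewrite (le_trans (ler_norm_sum _ _ _))//.
  have -> : 8 * (C * (8 / 3) ^+ symdeg u) * (supn n)%:R^-1 ^+ symdeg u =
     \sum_(m : {ffun 'I_3 -> bool}) C * (8 / 3 * (supn n)%:R^-1) ^+ symdeg u.
    rewrite sumr_const card_ffun card_bool card_ord [in RHS]exprMn.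
    rewrite -[RHS]mulr_natr.
    by rewrite (_ : (2 ^ 3)%:R = 8 :> R)//; ring.
  apply: ler_sum => m _; rewrite (cards0_eq Ss) /gsign big_set0 mul1r.
  have r0 : 0 <= (enorm (x - image_point y n m))^-1.
    by rewrite invr_ge0 enorm_ge0.
  have n1 := notin_box27 nbox; rewrite -(ler_nat R) in n1.
  have rn := rho_le m Ex Yy nbox.
  have n12 : (supn n)%:R^-1 <= 2^-1 :> R by rewrite lef_pV2 ?posrE//; lra.
  apply: (le_trans (HC _ _)); first lra.
  by rewrite ler_wpM2l// lerXn2r ?nnegrE ?mulr_ge0//; lra.
have [j jS] : {j | j \in S}.
  by apply/sigW; apply/set0Pn; rewrite -card_gt0 Ss.
have cSj : #|S :\ j| = s by move: Ss; rewrite (cardsD1 j) jS => -[].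
have [C C0 HC] := IH _ (dsym j u) cSj.
exists (5 / 4 * C) => [|x y n Ex Yy nbox]; first by rewrite mulr_ge0//; lra.
rewrite symdeg_dsym cSj addSnnS -Ss in HC.
(* The point [y - k] has j-th coordinate 0, where the term vanishes; its distance |y_j| < 5/4 to y
   is the source of the factor 5/4. *)
pose k : 'rV[R]_3 := y 0 j *: delta_mx 0 j.
have kE i : k 0 i = y 0 j * (i == j)%:R by rewrite !mxE/= eq_sym.
clearbody k.
have Yt t : 0 <= t <= 1 -> near_cube (y - k + t *: k).
  move=> /andP[t0 t1] i; rewrite !mxE kE.
  case: eqP => [->|_]; last by rewrite !mulr0 subr0 addr0; exact: Yy.
  rewrite mulr1 subrr add0r normrM ger0_norm//.
  have := Yy j; have := normr_ge0 (y 0 j); nra.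
have [|c c01] := @mean_value01 R
   (fun t => lterm S u (x + t *: 0) (y - k + t *: k) n)
   (fun t => dlterm S u 0 k (x + t *: 0) (y - k + t *: k) n).
  move=> t t01; apply: lterm_derive => m.
  by apply: enorm_neq0 => //; [rewrite scaler0 addr0|exact: Yt].
rewrite !scaler0 scale0r !addr0 scale1r subrK.
rewrite (@lterm_eq0 _ S u x (y - k) n j)//.
  rewrite subr0 => ->.
  rewrite /dlterm (bigD1 j)//= big1 ?addr0; last first.
    by move=> i /negPf ij; rewrite kE ij mxE mulr0 !mul0r subrr.
  rewrite mxE mul0r sub0r normrN kE eqxx mulr1 /toggle jS normrM.
  rewrite -(mulrA (5 / 4)).
  apply: ler_pM => //; first exact: ltW (Yy j).
  by apply: HC => //; exact: Yt.
by rewrite !mxE kE eqxx mulr1 subrr.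
Qed.

Definition rterm S u x y n : R := if n \in box27 then 0 else lterm S u x y n.

Definition drterm S u h k x y n : R :=
  \sum_j (h 0 j * rterm S (dsym j u) x y n
          - k 0 j * rterm (toggle j S) (dsym j u) x y n).

Lemma remainder_termE x y n :
  remainder_term x y n = rterm [set: 'I_3]%SET Phi_sym x y n.
Proof.
by rewrite /remainder_term /rterm; case: ifP => // _; exact: green_termE.
Qed.

Definition weight n : R := if n \in box27 then 0 else (supn n)%:R^-1 ^+ 4.

Lemma weight_ge0 n : 0 <= weight n.
Proof. by rewrite /weight; case: ifP => // _; rewrite exprn_ge0// invr_ge0. Qed.

(* Orders above 3 are summable over Z^3. *)
Definition decaying S u := (4 <= symdeg u + #|S|)%N.

Lemma decaying_dsym S u j : decaying S u -> decaying S (dsym j u).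
Proof. by rewrite /decaying symdeg_dsym; lia. Qed.

(** Toggling loses at most one sign, and the order gained by differentiating pays for it. *)
Lemma decaying_toggle S u j : decaying S u -> decaying (toggle j S) (dsym j u).
Proof. by rewrite /decaying symdeg_dsym; have := card_toggle j S; lia. Qed.

Lemma rterm_bound S u : decaying S u -> exists2 C : R, 0 <= C &
  forall x y n, enlarged_cube x -> near_cube y ->
  `|rterm S u x y n| <= C * weight n.
Proof.
move=> dS; have [C C0 HC] := lterm_bound S u; exists C => // x y n Ex Yy.
rewrite /rterm /weight; case: ifPn => nbox; first by rewrite normr0 mulr0.
apply: (le_trans (HC _ _ _ Ex Yy nbox)); rewrite ler_wpM2l//.
have n1 := notin_box27 nbox; rewrite -(ltr_nat R) in n1.
by apply: ler_wiXn2l => //; rewrite ?invr_ge0// invf_le1; lra.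
Qed.

(** Both boxes are cut out by strict positivity of affine functions, so this gives their convexity
    one face at a time. *)
Lemma convex_gt0 (a b t : R) : 0 < a -> 0 < b -> 0 <= t <= 1 ->
  0 < (1 - t) * a + t * b.
Proof.
move=> a0 b0 /andP[]; rewrite le_eqVlt => /predU1P[<- _|t0 t1]; first by lra.
by rewrite ltr_wpDl ?mulr_gt0// mulr_ge0 ?subr_ge0// ltW.
Qed.

Lemma enlarged_cube_convex x h t : enlarged_cube x -> enlarged_cube (x + h) ->
  0 <= t <= 1 -> enlarged_cube (x + t *: h).
Proof.
move=> Ex Exh t01 i; have := Ex i; have := Exh i; rewrite !mxE.
move: (x 0 i) (h 0 i) => a b /andP[b1 b2] /andP[a1 a2]; apply/andP; split.
  by have := @convex_gt0 (a + 1) (a + b + 1) t; lra.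
by have := @convex_gt0 (2 - a) (2 - (a + b)) t; lra.
Qed.

Lemma near_cube_convex y k t : near_cube y -> near_cube (y + k) ->
  0 <= t <= 1 -> near_cube (y + t *: k).
Proof.
move=> Yy Yyk t01 i; have := Yy i; have := Yyk i; rewrite !mxE !ltr_norml.
move: (y 0 i) (k 0 i) => a b /andP[b1 b2] /andP[a1 a2]; apply/andP; split.
  by have := @convex_gt0 (a + 5 / 4) (a + b + 5 / 4) t; lra.
by have := @convex_gt0 (5 / 4 - a) (5 / 4 - (a + b)) t; lra.
Qed.

Lemma rterm_derive S u x y h k n t : enlarged_cube (x + t *: h) ->
  near_cube (y + t *: k) ->
  is_derive t 1 (fun s => rterm S u (x + s *: h) (y + s *: k) n)
    (drterm S u h k (x + t *: h) (y + t *: k) n).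
Proof.
move=> Ex Yy; rewrite /drterm /rterm; case: (boolP (n \in box27)) => nbox.
  rewrite big1; first exact: is_derive_cst.
  by move=> j _; rewrite !mulr0 subrr.
by apply: lterm_derive => m; exact: enorm_neq0.
Qed.

Lemma drterm_bound S u : decaying S u -> exists2 C : R, 0 <= C &
  forall x y h k n, enlarged_cube x -> near_cube y ->
  `|drterm S u h k x y n| <= C * (`|h| + `|k|) * weight n.
Proof.
move=> dS.
(* One constant per j serves both kinds of term; the sigma type lets the constants be extracted and
   summed over j. *)
have H j : {C : R | 0 <= C /\ forall x y n, enlarged_cube x -> near_cube y ->
    `|rterm S (dsym j u) x y n| <= C * weight n /\
    `|rterm (toggle j S) (dsym j u) x y n| <= C * weight n}.
  apply: cid.
  have [C C0 HC] := rterm_bound (decaying_dsym j dS).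
  have [D D0 HD] := rterm_bound (decaying_toggle j dS).
  exists (C + D); split; first exact: addr_ge0.
  move=> x y n Ex Yy; have := weight_ge0 n; have := HC x y n Ex Yy.
  by have := HD x y n Ex Yy; split; nra.
pose C j := sval (H j).
have C0 j : 0 <= C j by case: (svalP (H j)).
have HC j := (svalP (H j)).2.
exists (\sum_j C j); first exact: sumr_ge0.
move=> x y h k n Ex Yy.
rewrite (le_trans (ler_norm_sum _ _ _))// !mulr_suml ler_sum// => j _.
have [H1 H2] := HC j x y n Ex Yy.
rewrite (le_trans (ler_normB _ _))// !normrM mulrDr mulrDl lerD//.
  by rewrite mulrAC mulrC ler_pM// coord_le_norm.
by rewrite mulrAC mulrC ler_pM// coord_le_norm.
Qed.

Lemma rterm_lipschitz S u : decaying S u -> exists2 C : R, 0 <= C &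
  forall x y x' y' n, enlarged_cube x -> near_cube y ->
  enlarged_cube x' -> near_cube y' ->
  `|rterm S u x' y' n - rterm S u x y n|
     <= C * (`|x' - x| + `|y' - y|) * weight n.
Proof.
move=> dS; have [C C0 HC] := drterm_bound dS; exists C => // x y x' y' n Ex Yy.
rewrite -{1 2}(subrKC x x') -{1 2}(subrKC y y').
move: (x' - x) (y' - y) => h k Ex' Yy'.
have [|c c01] := @mean_value01 R
   (fun t => rterm S u (x + t *: h) (y + t *: k) n)
   (fun t => drterm S u h k (x + t *: h) (y + t *: k) n).
  move=> t t01; apply: rterm_derive; first exact: enlarged_cube_convex.
  exact: near_cube_convex.
rewrite !scale0r !scale1r !addr0 => ->; apply: HC.
  exact: enlarged_cube_convex.
exact: near_cube_convex.
Qed.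

Lemma drterm_derive S u x y h k n t : enlarged_cube (x + t *: h) ->
  near_cube (y + t *: k) ->
  is_derive t 1 (fun s => drterm S u h k (x + s *: h) (y + s *: k) n)
    (\sum_j (h 0 j * drterm S (dsym j u) h k (x + t *: h) (y + t *: k) n
      - k 0 j *
        drterm (toggle j S) (dsym j u) h k (x + t *: h) (y + t *: k) n)).
Proof.
move=> Ex Yy; apply: is_derive_bigsum => j.
by apply: is_deriveB; apply: is_derive_mull; exact: rterm_derive.
Qed.

(** The mean value theorem is used twice: it turns the increment into [drterm] at a parameter c,
    then bounds the change of [drterm] between 0 and c by second derivatives. *)
Lemma rterm_taylor S u : decaying S u -> exists2 C : R, 0 <= C &
  forall x y x' y' n, enlarged_cube x -> near_cube y ->
  enlarged_cube x' -> near_cube y' ->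
  `|rterm S u x' y' n - rterm S u x y n - drterm S u (x' - x) (y' - y) x y n|
     <= C * (`|x' - x| + `|y' - y|) ^+ 2 * weight n.
Proof.
move=> dS.
have H j : {C : R | 0 <= C /\
    forall x y h k n, enlarged_cube x -> near_cube y ->
    `|drterm S (dsym j u) h k x y n| <= C * (`|h| + `|k|) * weight n /\
    `|drterm (toggle j S) (dsym j u) h k x y n|
       <= C * (`|h| + `|k|) * weight n}.
  apply: cid.
  have [C C0 HC] := drterm_bound (decaying_dsym j dS).
  have [D D0 HD] := drterm_bound (decaying_toggle j dS).
  exists (C + D); split; first exact: addr_ge0.
  move=> x y h k n Ex Yy; have := weight_ge0 n; have := HC x y h k n Ex Yy.
  have : 0 <= `|h| + `|k| by exact: addr_ge0.
  have := HD x y h k n Ex Yy; move: (`|h| + `|k|) => a.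
  move=> H1 a0 H2 w0; rewrite !mulrDl.
  have : 0 <= C * a * weight n by rewrite !mulr_ge0.
  have : 0 <= D * a * weight n by rewrite !mulr_ge0.
  by split; lra.
pose C j := sval (H j).
have C0 j : 0 <= C j by case: (svalP (H j)).
have HC j := (svalP (H j)).2.
exists (\sum_j C j); first exact: sumr_ge0.
move=> x y x' y' n Ex Yy.
rewrite -{1 2}(subrKC x x') -{1 2}(subrKC y y').
move: (x' - x) (y' - y) => h k Ex' Yy'.
have [|c /[dup] c01 /andP[c0 c1]] :=
    @mean_value01 R (fun t => rterm S u (x + t *: h) (y + t *: k) n)
   (fun t => drterm S u h k (x + t *: h) (y + t *: k) n).
  move=> t t01; apply: rterm_derive; first exact: enlarged_cube_convex.
  exact: near_cube_convex.
rewrite !scale0r !scale1r !addr0 => ->.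
have Ec : enlarged_cube (x + c *: h) by exact: enlarged_cube_convex.
have Yc : near_cube (y + c *: k) by exact: near_cube_convex.
(* The substitution s = c t rescales [0, c] to [0, 1] and brings out a factor c <= 1. *)
have [|d d01] := @mean_value01 R
   (fun t => drterm S u h k (x + (c * t) *: h) (y + (c * t) *: k) n)
   (fun t => c * \sum_j (h 0 j * drterm S (dsym j u) h k (x + (c * t) *: h)
      (y + (c * t) *: k) n - k 0 j * drterm (toggle j S) (dsym j u) h k
      (x + (c * t) *: h) (y + (c * t) *: k) n)).
  move=> t /andP[t0 t1].
  have ct01 : 0 <= c * t <= 1 by apply/andP; split; nra.
  have D : is_derive (c * t) 1
      (fun s => drterm S u h k (x + s *: h) (y + s *: k) n) _ :=
    drterm_derive S u n (enlarged_cube_convex Ex Ex' ct01)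
       (near_cube_convex Yy Yy' ct01).
  have Dc : is_derive t 1 (fun s => c * s) c.
    by apply: is_derive_eq; rewrite /GRing.scale/= mulr1.
  have := @is_derive1_comp R
     (fun s => drterm S u h k (x + s *: h) (y + s *: k) n)
     (fun s => c * s) t _ _ D Dc.
  by rewrite mulrC.
rewrite mulr0 mulr1 !scale0r !addr0 => ->.
have cd01 : 0 <= c * d <= 1.
  by move: d01 => /andP[d0 d1]; apply/andP; split; nra.
set x1 := x + _; set y1 := y + _.
have Ex1 : enlarged_cube x1 by exact: enlarged_cube_convex.
have Yy1 : near_cube y1 by exact: near_cube_convex.
rewrite normrM (ger0_norm c0).
apply: (le_trans (ler_piMl _ c1)) => //.
rewrite (le_trans (ler_norm_sum _ _ _))// !mulr_suml ler_sum// => j _.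
have [H1 H2] := HC j x1 y1 h k n Ex1 Yy1.
rewrite (le_trans (ler_normB _ _))// !normrM expr2.
have -> : C j * ((`|h| + `|k|) * (`|h| + `|k|)) * weight n =
  `|h| * (C j * (`|h| + `|k|) * weight n) +
  `|k| * (C j * (`|h| + `|k|) * weight n) by ring.
by rewrite lerD// ler_pM// coord_le_norm.
Qed.

End lattice_term_bounds.

(** * Absolutely convergent sums over a lattice *)

Section absolutely_summable.
Context {R : realType} {I : choiceType}.
Implicit Types (a b w : I -> R) (c W : R) (J : {fset I}).

Local Notation converges a := (cvg (partial_sum a @ totally)).

#[local] Existing Instance totally_filter.

Lemma partial_sumE a J : partial_sum a J = \sum_(i <- enum_fset J) a i.
Proof. by rewrite /partial_sum (big_seq_fsetE _ J xpredT a). Qed.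

Lemma sub_partial_sum a (A B : {fset I}) : (forall i, 0 <= a i) ->
  (A `<=` B)%fset -> partial_sum a A <= partial_sum a B.
Proof.
move=> a0 AB; rewrite !partial_sumE [leRHS](bigID (mem A))/=.
rewrite -[X in _ <= X + _]big_filter [X in _ <= X + _](perm_big (enum_fset A)).
  by rewrite lerDl sumr_ge0.
apply: uniq_perm; [exact: filter_uniq|exact: fset_uniq|move=> i].
rewrite mem_filter; have [iA|//] := boolP (i \in A).
by rewrite (fsubsetP AB _ iA).
Qed.

(** Partial sums of nonnegative terms increase along the net of finite sets, hence tend to their
    supremum. *)
Lemma nonneg_converges a W : (forall i, 0 <= a i) ->
  (forall J, partial_sum a J <= W) -> converges a.
Proof.
move=> a0 aW; apply/cvg_ex; exists (sup (range (partial_sum a))).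
have hs : has_sup (range (partial_sum a)).
  split; first by exists (partial_sum a fset0); exists fset0.
  by exists W => _ [J _ <-].
apply/cvgrPdist_le => e e0.
have [_ [J _ <-] HJ] := sup_adherent e0 hs.
exists J => // B /= JB.
have HB : partial_sum a B <= sup (range (partial_sum a)).
  by apply: sup_upper_bound => //; exists B.
have := sub_partial_sum a0 JB.
by rewrite ger0_norm ?subr_ge0//; lra.
Qed.

Lemma partial_sumD a b J :
  partial_sum (fun i => a i + b i) J = partial_sum a J + partial_sum b J.
Proof. exact: big_split. Qed.

Lemma partial_sumZ c a J :
  partial_sum (fun i => c * a i) J = c * partial_sum a J.
Proof. by rewrite /partial_sum mulr_sumr. Qed.

Lemma convergesD a b : converges a -> converges b ->
  converges (fun i => a i + b i).
Proof.
move=> ca cb; rewrite (_ : partial_sum _ = partial_sum a \+ partial_sum b).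
  exact: is_cvgD.
by apply/funext => J; rewrite partial_sumD.
Qed.

Lemma convergesZ c a : converges a -> converges (fun i => c * a i).
Proof.
move=> ca; rewrite (_ : partial_sum _ = fun J => c * partial_sum a J).
  exact: is_cvgMr.
by apply/funext => J; rewrite partial_sumZ.
Qed.

Lemma usumD a b : converges a -> converges b ->
  sum (fun i => a i + b i) = sum a + sum b.
Proof.
move=> ca cb; apply: cvg_lim => //.
rewrite (_ : partial_sum _ = partial_sum a \+ partial_sum b).
  exact: cvgD.
by apply/funext => J; rewrite partial_sumD.
Qed.

Lemma usumZ c a : converges a -> sum (fun i => c * a i) = c * sum a.
Proof.
move=> ca; apply: cvg_lim => //.
rewrite (_ : partial_sum _ = fun J => c * partial_sum a J).
  exact: cvgMr.
by apply/funext => J; rewrite partial_sumZ.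
Qed.

Lemma usumB a b : converges a -> converges b ->
  sum (fun i => a i - b i) = sum a - sum b.
Proof.
move=> ca cb; rewrite (_ : (fun _ => _) = fun i => a i + -1 * b i).
  by rewrite usumD ?usumZ ?mulN1r//; exact: convergesZ.
by apply/funext => i; rewrite mulN1r.
Qed.

Lemma convergesB a b : converges a -> converges b ->
  converges (fun i => a i - b i).
Proof.
move=> ca cb; rewrite (_ : (fun i => _ - _) = fun i => a i + -1 * b i).
  by apply: convergesD => //; exact: convergesZ.
by apply/funext => i; rewrite mulN1r.
Qed.

Lemma converges0 : converges (fun _ : I => 0 : R).
Proof.
by apply: (@nonneg_converges _ 0) => // J; rewrite /partial_sum big1.
Qed.

Lemma usum0 : sum (fun _ : I => 0 : R) = 0.
Proof.
by have := @usumZ 0 _ converges0; under eq_fun do rewrite mul0r; rewrite mul0r.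
Qed.

Lemma usum_sum (K : finType) (a : K -> I -> R) :
  (forall k, converges (a k)) ->
  sum (fun i => \sum_k a k i) = \sum_k sum (a k).
Proof.
move=> ca; rewrite /index_enum.
(* The induction carries convergence along with the value, because additivity of [sum] requires both
   summands to converge. *)
suff : converges (fun i => \sum_(k <- Finite.enum K) a k i) /\
   sum (fun i => \sum_(k <- Finite.enum K) a k i) =
   \sum_(k <- Finite.enum K) sum (a k) by case.
elim: (Finite.enum K) => [|k s [IH1 IH2]].
  rewrite big_nil; under eq_fun do rewrite big_nil.
  by split; [exact: converges0|exact: usum0].
rewrite big_cons -IH2; under eq_fun do rewrite big_cons.
by split; [exact: convergesD|exact: usumD].
Qed.

Variables (w : I -> R) (W : R).
Hypothesis w0 : forall i, 0 <= w i.
Hypothesis wW : forall J, partial_sum w J <= W.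

(** The family [a + c w] is nonnegative with partial sums at most 2 |c| W, so it converges, and
    subtracting [c w] recovers [a]. *)
Lemma dominated_converges a c : (forall i, `|a i| <= c * w i) -> converges a.
Proof.
move=> aw.
have cw0 i : 0 <= c * w i by exact: le_trans (aw i).
have dw : converges (fun i => c * w i).
  exact/convergesZ/(@nonneg_converges _ W).
have c1 : converges (fun i => a i + c * w i).
  apply: (@nonneg_converges _ (2 * `|c| * W)) => [i|J].
    by have := aw i; rewrite ler_norml; lra.
  apply: (@le_trans _ _ (partial_sum (fun i => 2 * `|c| * w i) J)).
    apply: ler_sum => i _; have := aw (val i); rewrite ler_norml => /andP[_ H].
    have : c * w (val i) <= `|c| * w (val i) by rewrite ler_wpM2r// ler_norm.
    lra.
  by rewrite partial_sumZ ler_wpM2l// mulr_ge0.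
rewrite (_ : a = fun i => (a i + c * w i) - c * w i); first exact: convergesB.
by apply/funext => i; rewrite addrK.
Qed.

Lemma dominated_usum_le a c : 0 <= c -> (forall i, `|a i| <= c * w i) ->
  `|sum a| <= c * W.
Proof.
move=> c0 aw; have ca := dominated_converges aw.
have H J : `|partial_sum a J| <= c * W.
  apply: le_trans (ler_norm_sum _ _ _) _.
  apply: (@le_trans _ _ (partial_sum (fun i => c * w i) J)).
    by apply: ler_sum => i _; exact: aw.
  by rewrite partial_sumZ ler_wpM2l.
rewrite ler_norml; apply/andP; split.
  apply: limr_ge => //; apply: nearW => J.
  by have := H J; rewrite ler_norml => /andP[].
apply: limr_le => //; apply: nearW => J.
by have := H J; rewrite ler_norml => /andP[].
Qed.

End absolutely_summable.

(** * Summability of the inverse fourth power over the lattice *)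

Section weight_series.
Context {R : realType}.
Implicit Types n : {ffun 'I_3 -> int}.

Definition box (K : nat) : seq {ffun 'I_3 -> int} :=
  [seq [ffun i => (f i)%:Z - K%:Z] | f : {ffun 'I_3 -> 'I_(K.*2.+1)}].

Lemma uniq_box K : uniq (box K).
Proof.
rewrite map_inj_uniq ?enum_uniq// => f g /ffunP fg; apply/ffunP => i.
by have := fg i; rewrite !ffunE => /addIr[] /ord_inj.
Qed.

Lemma size_box K : size (box K) = (K.*2.+1 ^ 3)%N.
Proof. by rewrite size_map -cardE card_ffun !card_ord. Qed.

Lemma mem_box K n : (n \in box K) = (supn n <= K)%N.
Proof.
apply/mapP/bigmax_leqP => [[f _ ->] i _|H].
  by rewrite ffunE; case: (f i) => l /= lK; lia.
exists [ffun i => inord `|(n i + K%:Z)%R|%N]; first by rewrite mem_enum.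
apply/ffunP => i; rewrite !ffunE; move: (n i) (H i isT) => a aK.
by rewrite inordK; lia.
Qed.

(* There are 24 k^2 + 2 <= 26 k^2 points with max |n_i| = k, and
   1 / k^2 <= 1 / (k - 1) - 1 / k. *)
Lemma weight_box K :
  \sum_(n <- box K.+1) weight n <= 26 * (1 - K.+1%:R^-1) :> R.
Proof.
elim: K => [|K IH].
  (* All points of [box 1] lie in [box27], where the weight vanishes. *)
  rewrite big1_seq ?invr1 ?subrr ?mulr0// => n /andP[_].
  rewrite mem_box => n1; rewrite /weight; case: ifPn => // /notin_box27.
  by rewrite ltnNge n1.
rewrite (bigID (fun n => supn n <= K.+1)%N)/=.
have pm : perm_eq [seq n <- box K.+2 | (supn n <= K.+1)%N] (box K.+1).
  apply: uniq_perm; [exact/filter_uniq/uniq_box|exact: uniq_box|move=> n].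
  by rewrite mem_filter !mem_box; lia.
rewrite -big_filter (perm_big _ pm)/=.
have -> : \sum_(n <- box K.+2 | ~~ (supn n <= K.+1)%N) weight n =
    (24 * K.+2%:R ^+ 2 + 2) * K.+2%:R^-1 ^+ 4 :> R.
  rewrite big_seq_cond.
  rewrite (eq_bigr (fun=> K.+2%:R^-1 ^+ 4)) => [|n]; last first.
    rewrite mem_box -ltnNge => /andP[n2 n1].
    rewrite /weight ifN; last first.
      by apply: contraL n1 => /in_box27; lia.
    by rewrite (_ : supn n = K.+2)//; lia.
  rewrite -big_seq_cond big_const_seq iter_addr_0 -[LHS]mulr_natl.
  congr (_ * _).
  have /perm_size := pm; rewrite size_filter size_box => E.
  have := count_predC (fun n => supn n <= K.+1)%N (box K.+2).
  rewrite E size_box => {}E.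
  have {}E : count (fun n => ~~ (supn n <= K.+1)%N) (box K.+2) =
     (K.+2.*2.+1 ^ 3 - K.+1.*2.+1 ^ 3)%N by rewrite -E addKn.
  rewrite E (_ : (_ - _)%N = (24 * K.+2 ^ 2 + 2)%N).
    by rewrite natrD natrM natrX.
  by rewrite -!muln2 !expnS expn0; nia.
apply: (@le_trans _ _ (26 * (1 - K.+1%:R^-1) + 26 * (K.+1%:R^-1 - K.+2%:R^-1))).
  rewrite lerD//.
  rewrite -[K.+2%:R]natr1; set k : R := K.+1%:R.
  have k1 : 1 <= k by rewrite ler1n.
  (* The shell has radius k + 1 here; with the factor (k + 1)^-4 split off, the claim becomes 24 (k
     + 1)^2 + 2 <= 26 (k + 1)^3 / k. *)
  have -> : 26 * (k^-1 - (k + 1)^-1) = 26 * (k + 1) ^+ 3 / k * (k + 1)^-1 ^+ 4.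
    by field; apply/andP; split; lra.
  rewrite ler_wpM2r ?exprn_ge0 ?invr_ge0//; first lra.
  by rewrite ler_pdivlMr; [nra|lra].
by rewrite -mulrDr addrA subrK.
Qed.

Lemma weight_summable (J : {fset {ffun 'I_3 -> int}}) :
  partial_sum weight J <= 26 :> R.
Proof.
(* Every finite set lies in a cube; the radius is raised to K + 1 because [weight_box] starts at
   radius 1. *)
pose K := (\max_(n <- enum_fset J) supn n)%N.
pose B : {fset {ffun 'I_3 -> int}} := seq_fset tt (box K.+1).
have JB : (J `<=` B)%fset.
  apply/fsubsetP => n nJ; rewrite seq_fsetE mem_box leqW//.
  by apply: (@leq_bigmax_seq _ _ xpredT).
apply: (le_trans (sub_partial_sum (@weight_ge0 R) JB)).
rewrite partial_sumE (perm_big (box K.+1)); last first.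
  apply: uniq_perm; [exact: fset_uniq|exact: uniq_box|move=> n].
  by rewrite seq_fsetE.
apply: (le_trans (weight_box K)).
by rewrite ler_piMr// lerBlDr lerDl invr_ge0.
Qed.
End weight_series.

(** * The remainder series *)

#[local] Existing Instance totally_filter.

Section remainder_series.
Context {R : realType}.
Implicit Types (z h k x y : 'rV[R]_3) (t : R) (i j : 'I_3) (S : {set 'I_3})
  (n : {ffun 'I_3 -> int}) (m : {ffun 'I_3 -> bool}) (u : @sym R).

Definition rsum S u x y : R := sum (rterm S u x y).

Definition drsum S u h k x y : R :=
  \sum_j (h 0 j * rsum S (dsym j u) x y
          - k 0 j * rsum (toggle j S) (dsym j u) x y).

Lemma green_remainderE x y :
  green_remainder x y = rsum [set: 'I_3]%SET Phi_sym x y.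
Proof.
by congr (sum _); apply/funext => n; exact: remainder_termE.
Qed.

Let weight0 := @weight_ge0 R.
Let weightW := @weight_summable R.

Lemma rterm_converges S u x y : decaying S u -> enlarged_cube x ->
  near_cube y -> cvg (partial_sum (rterm S u x y) @ totally).
Proof.
move=> dS Ex Yy; have [C C0 HC] := rterm_bound dS.
by apply: (dominated_converges weight0 weightW (c := C)) => n; exact: HC.
Qed.

(** The termwise constants are uniform in x and y, so multiplying them by the total weight bound 26
    gives constants for the sum. The Lipschitz and Taylor bounds below arise in the same way. *)
Lemma rsum_bound S u : decaying S u -> exists2 C : R, 0 <= C &
  forall x y, enlarged_cube x -> near_cube y -> `|rsum S u x y| <= C.
Proof.
move=> dS; have [C C0 HC] := rterm_bound dS.
exists (C * 26) => [|x y Ex Yy]; first by rewrite mulr_ge0.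
by apply: (dominated_usum_le weight0 weightW) => // n; exact: HC.
Qed.

Lemma rsum_lipschitz S u : decaying S u -> exists2 C : R, 0 <= C &
  forall x y x' y', enlarged_cube x -> near_cube y ->
  enlarged_cube x' -> near_cube y' ->
  `|rsum S u x' y' - rsum S u x y| <= C * (`|x' - x| + `|y' - y|).
Proof.
move=> dS; have [C C0 HC] := rterm_lipschitz dS.
exists (C * 26) => [|x y x' y' Ex Yy Ex' Yy']; first by rewrite mulr_ge0.
rewrite -usumB; [|exact: rterm_converges..].
rewrite mulrAC; apply: (dominated_usum_le weight0 weightW).
  by rewrite mulr_ge0// addr_ge0.
by move=> n; exact: HC.
Qed.

Lemma drterm_converges S u h k x y : decaying S u -> enlarged_cube x ->
  near_cube y -> cvg (partial_sum (drterm S u h k x y) @ totally).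
Proof.
move=> dS Ex Yy; have [C C0 HC] := drterm_bound dS.
by apply: (dominated_converges weight0 weightW) => n; exact: HC.
Qed.

Lemma drterm_usum S u h k x y : decaying S u -> enlarged_cube x ->
  near_cube y -> sum (drterm S u h k x y) = drsum S u h k x y.
Proof.
move=> dS Ex Yy.
have c1 j := rterm_converges (decaying_dsym j dS) Ex Yy.
have c2 j := rterm_converges (decaying_toggle j dS) Ex Yy.
rewrite /drterm usum_sum => [|j]; last first.
  by apply: convergesB; apply: convergesZ; [exact: c1|exact: c2].
apply: eq_bigr => j _.
rewrite usumB; last 2 first.
- by apply: convergesZ; exact: c1.
- by apply: convergesZ; exact: c2.
by rewrite !usumZ; [|exact: c2|exact: c1].
Qed.

Lemma rsum_taylor S u : decaying S u -> exists2 C : R, 0 <= C &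
  forall x y x' y', enlarged_cube x -> near_cube y ->
  enlarged_cube x' -> near_cube y' ->
  `|rsum S u x' y' - rsum S u x y - drsum S u (x' - x) (y' - y) x y|
     <= C * (`|x' - x| + `|y' - y|) ^+ 2.
Proof.
move=> dS; have [C C0 HC] := rterm_taylor dS.
exists (C * 26) => [|x y x' y' Ex Yy Ex' Yy']; first by rewrite mulr_ge0.
have c1 : cvg (partial_sum (rterm S u x y) @ totally) by exact: rterm_converges.
have c2 : cvg (partial_sum (rterm S u x' y') @ totally).
  exact: rterm_converges.
rewrite -drterm_usum// -usumB// -usumB//; last 2 first.
- exact: convergesB.
- exact: drterm_converges.
rewrite mulrAC; apply: (dominated_usum_le weight0 weightW).
  by rewrite mulr_ge0// exprn_ge0// addr_ge0.
by move=> n; exact: HC.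
Qed.

(** The signs do not depend on i, so the Laplacian passes inside the sum over reflections, and
    outside [box27] the points x - y_{n,m} are nonzero. *)
Lemma rsum_laplace S u x y :
  (forall j, decaying S (dsym j (dsym j u))) ->
  (forall z, enorm z != 0 -> \sum_i ev (dsym i (dsym i u)) z = 0) ->
  enlarged_cube x -> near_cube y ->
  \sum_i rsum S (dsym i (dsym i u)) x y = 0.
Proof.
move=> dS u0 Ex Yy; rewrite -usum_sum => [|i]; last exact: rterm_converges.
rewrite (_ : (fun _ => _) = fun=> 0); first exact: usum0.
apply/funext => n; rewrite /rterm; case: (boolP (n \in box27)) => nbox.
  by rewrite big1.
rewrite exchange_big big1// => m _ /=.
by rewrite -mulr_sumr u0 ?mulr0//; exact: enorm_neq0.
Qed.

Lemma decaying_Phi : decaying [set: 'I_3]%SET (Phi_sym : @sym R).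
Proof. by rewrite /decaying /= cardsT card_ord. Qed.

Lemma near_cube_open y : near_cube y -> \forall z \near y, near_cube z.
Proof.
move=> Yy.
have H i : nbhs y [set z : 'rV[R]_3 | `|z 0 i| < 5 / 4].
  have : (fun z : 'rV[R]_3 => `|z 0 i|) @ y --> `|y 0 i|.
    exact: (cvg_norm (@coord_continuous R 1 3 0 i y)).
  by move/cvgr_lt; apply; exact: Yy.
exact: (filter_forall _ H).
Qed.

Lemma enlarged_cube_open : open (@enlarged_cube R).
Proof.
rewrite openE => x Ex; rewrite /interior.
have H i : nbhs x [set z : 'rV[R]_3 | -1 < z 0 i < 2].
  have c : (fun z : 'rV[R]_3 => z 0 i) @ x --> x 0 i.
    exact: (@coord_continuous R 1 3 0 i x).
  have /andP[x1 x2] := Ex i.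
  have H1 : nbhs x [set z : 'rV[R]_3 | -1 < z 0 i] by move/cvgr_gt : c; apply.
  have H2 : nbhs x [set z : 'rV[R]_3 | z 0 i < 2] by move/cvgr_lt : c; apply.
  by near=> z; apply/andP; split; near: z.
exact: (filter_forall _ H).
Unshelve. all: by end_near. Qed.

Lemma cube_near_cube y : cube y -> near_cube y.
Proof.
by move=> Hy i; have := Hy i; rewrite ltr_norml => /andP[? ?]; apply/andP; lra.
Qed.

(** The partial sum no longer changes once the finite set contains [s]. *)
Lemma finite_usum (I : choiceType) (a : I -> R) (s : seq I) : uniq s ->
  (forall l, l \notin s -> a l = 0) ->
  cvg (partial_sum a @ totally) /\ sum a = \sum_(l <- s) a l.
Proof.
move=> us sa.
suff : partial_sum a @ totally --> \sum_(l <- s) a l.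
  move=> H; split; last by apply: cvg_lim.
  by apply/cvg_ex; exists (\sum_(l <- s) a l).
apply: cvg_near_cst; exists (seq_fset tt s) => // J sJ0.
have sJ l : l \in s -> l \in J.
  by move=> ls; apply: (fsubsetP sJ0); rewrite seq_fsetE.
rewrite partial_sumE (bigID (mem s))/= [X in _ + X]big1 ?addr0//.
rewrite -big_filter; apply: perm_big; apply: uniq_perm => //.
  exact/filter_uniq/fset_uniq.
move=> l; rewrite mem_filter; have [is_|//] := boolP (l \in s).
by rewrite sJ.
Qed.

Lemma green_decomposition x y : enlarged_cube x -> cube y ->
  lattice_cvg (green_term x y) /\
  green x y = green27 x y + green_remainder x y.
Proof.
move=> Ex /cube_near_cube Yy.
have box27E n : (n \in box27) = (n \in box 1).
  rewrite mem_box; apply/idP/idP; first exact: in_box27.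
  by apply: contraTT => /notin_box27; rewrite ltnNge.
(* The series splits into this finitely supported family and the remainder terms, each of which
   converges. *)
pose a n : R := if n \in box27 then green_term x y n else 0.
have [|ca sa] := @finite_usum _ a _ (uniq_box 1).
  by move=> n; rewrite -box27E => /negPf nb; rewrite /a nb.
have cr : cvg (partial_sum (remainder_term x y) @ totally).
  rewrite (_ : remainder_term x y = rterm [set: 'I_3]%SET Phi_sym x y).
    exact: (rterm_converges decaying_Phi).
  by apply/funext => n; exact: remainder_termE.
have E : green_term x y = fun n => a n + remainder_term x y n.
  apply/funext => n; rewrite /a /remainder_term.
  by case: ifP; rewrite ?addr0 ?add0r.
split; first by rewrite /lattice_cvg E; exact: convergesD.
rewrite /green E usumD// sa; congr (_ + _).
rewrite /green27 (_ : box27 = [set` box 1]); last first.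
  apply/seteqP; split => n nbox; last by apply: set_mem; rewrite box27E.
  by rewrite /mkset -box27E; exact: mem_set.
rewrite -fsbig_seq ?uniq_box//; apply: eq_big_seq => n.
by rewrite -box27E /a => ->.
Qed.

End remainder_series.

(** * Regularity from uniform Taylor expansions *)

Section taylor.
Context {R : realType}.
Implicit Types (U : set 'rV[R]_3).

(** Dividing a quadratic error by h leaves an error of at most |M| |h| in the difference
    quotient. *)
Lemma taylor_is_derive (V : normedModType R) (u : V -> R) (x v : V) (L M : R) :
  (\forall h \near 0, `|u (x + h *: v) - u x - h * L| <= M * h ^+ 2) ->
  is_derive x v u L.
Proof.
move=> H.
suff D : (fun h => h^-1 *: ((u \o shift x) (h *: v) - u x)) @ 0^' --> L.
  by split; [apply/cvg_ex; exists L|exact: cvg_lim].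
apply/cvgrPdist_le => e e0; near=> h.
have h0 : h != 0 by near: h; exact: nbhs_dnbhs_neq.
have hn : 0 < `|h| by rewrite normr_gt0.
have Hh : `|u (x + h *: v) - u x - h * L| <= M * h ^+ 2.
  by near: h; exact: nbhs_dnbhs.
have he : `|h| <= e / (`|M| + 1).
  near: h; apply: nbhs_dnbhs; near=> h.
  rewrite -[h]subr0 distrC; near: h; apply: cvgr_dist_le => //.
  by rewrite divr_gt0// ltr_pwDr.
rewrite /= /GRing.scale/= [_ + x]addrC distrC -(ler_pM2l hn) -normrM mulrBr.
rewrite mulVKf//.
apply: (le_trans Hh).
rewrite -real_normK ?num_real// expr2 mulrCA ler_pM2l//.
apply: (@le_trans _ _ ((`|M| + 1) * `|h|)).
  by rewrite ler_wpM2r// (le_trans (ler_norm _))// lerDl.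
by rewrite mulrC -ler_pdivlMr// ltr_pwDr.
Unshelve. all: by end_near. Qed.

Definition lipschitz_in (V : normedModType R) (U : set V) (u : V -> R) : Prop :=
  exists C : R, forall x x', U x -> U x' -> `|u x' - u x| <= C * `|x' - x|.

(** Such uniform inequalities survive lattice sums and boundary integrals, and so stand in for
    theorems on differentiating under the sum or the integral. *)
Definition taylor_in U (u : 'rV[R]_3 -> R) (du : 'I_3 -> 'rV[R]_3 -> R) :
    Prop :=
  exists C : R, forall x x', U x -> U x' ->
    `|u x' - u x - \sum_j (x' - x) 0 j * du j x| <= C * `|x' - x| ^+ 2.

Lemma lipschitz_continuous (V : normedModType R) (U : set V) u x :
  open U -> lipschitz_in U u -> U x -> {for x, continuous u}.
Proof.
move=> oU [C HC] Ux; have nU : nbhs x U by exact: open_nbhs_nbhs.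
apply/cvgrPdist_le => e e0; near=> z.
have Uz : U z by near: z; exact: nU.
rewrite distrC (le_trans (HC _ _ Ux Uz))//.
have ze : `|z - x| <= e / (`|C| + 1).
  rewrite distrC; near: z; apply: cvgr_dist_le => //.
  by rewrite divr_gt0// ltr_pwDr.
apply: (@le_trans _ _ ((`|C| + 1) * `|z - x|)).
  by rewrite ler_wpM2r// (le_trans (ler_norm _))// lerDl.
by rewrite mulrC -ler_pdivlMr// ltr_pwDr.
Unshelve. all: by end_near. Qed.

Lemma taylor_partial U u du i x : open U -> taylor_in U u du -> U x ->
  is_derive x (delta_mx 0 i) u (du i x).
Proof.
move=> oU [C HC] Ux; have nU : nbhs x U by exact: open_nbhs_nbhs.
apply: (@taylor_is_derive _ _ _ _ _ (C * `|delta_mx 0 i : 'rV[R]_3| ^+ 2)).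
have c : (fun h : R => x + h *: delta_mx 0 i) @ (0 : R) --> x.
  rewrite -[X in _ --> X]addr0; apply: cvgD; first exact: cvg_cst.
  rewrite -[X in _ --> X](scale0r (delta_mx 0 i)).
  exact: (cvgZr_tmp (cvg_id)).
near=> h.
have Uh : U (x + h *: delta_mx 0 i).
  by near: h; apply: c; exact: nU.
have := HC _ _ Ux Uh; rewrite [x + _ - x]addrC addKr.
rewrite (bigD1 i)//= big1 => [|j ji]; last first.
  by rewrite !mxE eqxx (negPf ji)/= mulr0 mul0r.
rewrite !mxE !eqxx mulr1 addr0 normrZ exprMn real_normK ?num_real//.
by rewrite [h ^+ 2 * _]mulrC mulrA.
Unshelve. all: by end_near. Qed.

Lemma taylor_C1 U u du : open U -> taylor_in U u du ->
  (forall i, lipschitz_in U (du i)) -> C1_on U u.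
Proof.
move=> oU Tu Ldu i x Ux; have [du1 _] := taylor_partial i oU Tu Ux.
split => //; have nU : nbhs x U by exact: open_nbhs_nbhs.
(* The two functions are known to agree only on [U], which is enough to transfer continuity at x
   since [U] is open. *)
have duE : {near x, du i =1 partial i u}.
  apply: filterS nU => z Uz.
  by have [_ <-] := taylor_partial i oU Tu Uz.
have E : du i x = partial i u x by have [_ <-] := taylor_partial i oU Tu Ux.
have H : du i @ x --> du i x := lipschitz_continuous oU (Ldu i) Ux.
suff : partial i u @ x --> partial i u x by [].
by rewrite -[X in _ --> X]E; apply: cvg_trans H; exact: (near_eq_cvg duE).
Qed.

Lemma taylor_eq_in U u v du : (forall x, U x -> u x = v x) ->
  taylor_in U u du -> taylor_in U v du.
Proof. by move=> uv [C HC]; exists C => x x' Ux Ux'; rewrite -!uv// HC. Qed.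

(** The expansion of u identifies [du] with the partial derivatives on [U]; the expansions of [du]
    then carry over to them and identify [ddu]. Continuity comes from the Lipschitz bounds. *)
Lemma harmonic_of_taylor U u du ddu : open U -> taylor_in U u du ->
  (forall i, lipschitz_in U (du i)) -> (forall i, taylor_in U (du i) (ddu i)) ->
  (forall i j, lipschitz_in U (ddu i j)) ->
  (forall x, U x -> \sum_i ddu i i x = 0) -> harmonic_on U u.
Proof.
move=> oU Tu Ldu Tdu Lddu Lap.
have duE i x : U x -> du i x = partial i u x.
  by move=> Ux; have [_ <-] := taylor_partial i oU Tu Ux.
have Tp i : taylor_in U (partial i u) (ddu i).
  by apply: taylor_eq_in (Tdu i) => x; exact: duE.
split; first split.
- exact: taylor_C1 Ldu.
- by move=> i; exact: taylor_C1 (Lddu i).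
- move=> x Ux; rewrite -(Lap _ Ux); apply: eq_bigr => i _.
  by have [_ <-] := taylor_partial i oU (Tp i) Ux.
Qed.

End taylor.

(** * Harmonicity in x and differentiability in y of the remainder *)

Section green_remainder_regularity.
Context {R : realType}.
Implicit Types (x y : 'rV[R]_3) (S : {set 'I_3}) (u : @sym R).

Lemma rsum_lipschitz_in S u y : decaying S u -> near_cube y ->
  lipschitz_in enlarged_cube (rsum S u ^~ y).
Proof.
move=> dS Yy; have [C C0 HC] := rsum_lipschitz dS.
exists C => x x' Ex Ex'; have := HC _ _ _ _ Ex Yy Ex' Yy.
by rewrite subrr normr0 addr0.
Qed.

Lemma rsum_taylor_in S u y : decaying S u -> near_cube y ->
  taylor_in enlarged_cube (rsum S u ^~ y) (fun j => rsum S (dsym j u) ^~ y).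
Proof.
move=> dS Yy; have [C C0 HC] := rsum_taylor dS.
exists C => x x' Ex Ex'; have := HC _ _ _ _ Ex Yy Ex' Yy.
rewrite subrr normr0 addr0 /drsum.
by under eq_bigr do rewrite [X in _ - X * _]mxE mul0r subr0.
Qed.

Lemma green_remainder_harmonic y : near_cube y ->
  harmonic_on enlarged_cube (fun x => green_remainder x y).
Proof.
move=> Yy.
rewrite (_ : (fun _ => _) = rsum [set: 'I_3]%SET Phi_sym ^~ y); last first.
  by apply/funext => x; exact: green_remainderE.
have dP := @decaying_Phi R.
apply: (@harmonic_of_taylor _ _ _
    (fun i => rsum [set: 'I_3]%SET (dsym i Phi_sym) ^~ y)
    (fun i j => rsum [set: 'I_3]%SET (dsym j (dsym i Phi_sym)) ^~ y)).
- exact: enlarged_cube_open.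
- exact: rsum_taylor_in.
- by move=> i; apply: rsum_lipschitz_in => //; exact: decaying_dsym.
- by move=> i; apply: rsum_taylor_in => //; exact: decaying_dsym.
- by move=> i j; apply: rsum_lipschitz_in => //; do 2 apply: decaying_dsym.
- move=> x Ex; apply: rsum_laplace => //; last exact: laplace_Phi.
  by move=> j; do 2 apply: decaying_dsym.
Qed.

(** The direction is arbitrary, so the formula also covers the values of [outward_normal] on the
    edges, which are not unit vectors. *)
Lemma green_remainder_derive x y v : enlarged_cube x -> near_cube y ->
  is_derive y v (green_remainder x)
    (- \sum_j v 0 j * rsum (toggle j [set: 'I_3]%SET) (dsym j Phi_sym) x y).
Proof.
move=> Ex Yy; have [C C0 HC] := rsum_taylor (@decaying_Phi R).
apply: (@taylor_is_derive _ _ _ _ _ _ (C * `|v| ^+ 2)).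
have c : (fun h : R => y + h *: v) @ (0 : R) --> y.
  rewrite -[X in _ --> X]addr0; apply: cvgD; first exact: cvg_cst.
  rewrite -[X in _ --> X](scale0r v).
  exact: (cvgZr_tmp (cvg_id)).
near=> h.
have Yh : near_cube (y + h *: v).
  by near: h; apply: c; exact: near_cube_open.
have := HC _ _ _ _ Ex Yy Ex Yh; rewrite !green_remainderE.
rewrite [y + _ - y]addrC addKr subrr normr0 add0r normrZ exprMn.
rewrite real_normK ?num_real//.
rewrite [_ * `|v| ^+ 2]mulrC mulrA; congr (`| _ - _| <= _).
rewrite /drsum mulrN mulr_sumr -sumrN; apply: eq_bigr => j _.
by rewrite !mxE mul0r sub0r mulrA.
Unshelve. all: by end_near. Qed.
End green_remainder_regularity.

(** * Bounded kernels and measurability *)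

Section bounded_pairing.
Context d (T : measurableType d) (R : realType).
Variables (mu : {measure set T -> \bar R}) (D : set T) (g : T -> R).
Hypotheses (mD : measurable D) (ig : mu.-integrable D (fun t => (g t)%:E)).
Implicit Types (k : T -> R) (B : R).

Lemma bounded_pairing_integrable k B : measurable_fun D k ->
  (forall t, D t -> `|k t| <= B) -> mu.-integrable D (fun t => (k t * g t)%:E).
Proof.
move=> mk kB.
have bk : [bounded k t | t in D].
  exists B; split; first exact: num_real.
  by move=> M BM t Dt; exact: le_trans (kB t Dt) (ltW BM).
exact: (integrableMr mD mk bk ig).
Qed.

Lemma bounded_pairing_le k B : measurable_fun D k ->
  (forall t, D t -> `|k t| <= B) ->
  `|\int[mu]_(t in D) (k t * g t)| <= B * \int[mu]_(t in D) `|g t|.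
Proof.
move=> mk kB; have ik := bounded_pairing_integrable mk kB.
have iabs (f : T -> R) : mu.-integrable D (fun t => (f t)%:E) ->
    mu.-integrable D (fun t => `|f t|%:E).
  by move=> H; exact: (integrable_norm H).
apply: le_trans (le_normr_Rintegral mD ik) _.
rewrite -RintegralZl//; last exact: iabs.
apply: le_Rintegral => //; first exact: iabs.
  rewrite (_ : EFin \o _ = fun t => B%:E * `|g t|%:E)%E.
    exact: integrableZl (iabs _ ig).
  by apply/funext => t /=; rewrite EFinM.
by move=> t Dt; rewrite normrM ler_wpM2r// kB.
Qed.

End bounded_pairing.

Section lipschitz_measurable.
Context {R : realType}.

Lemma rat_dense (s e : R) : 0 < e -> exists q : rat, `|s - ratr q| < e.
Proof.
move=> e0; have [|q] := @rat_in_itvoo R (s - e) (s + e); first by lra.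
rewrite in_itv/= => /andP[q1 q2]; exists q.
by rewrite ltr_norml; apply/andP; lra.
Qed.

Lemma lipschitz_measurable
    (f : measurableTypeR R * measurableTypeR R -> R) (C : R) :
  (forall p q, `|f p - f q| <= C * (`|p.1 - q.1 : R| + `|p.2 - q.2 : R|)) ->
  measurable_fun setT f.
Proof.
move=> fC mT; apply: (measurability _ (RGenOInfty.measurableE R)) => //.
move=> _ [_ [a ->] <-]; rewrite setTI.
pose r (q : rat * rat) : measurableTypeR R * measurableTypeR R :=
  (ratr q.1, ratr q.2).
(* f is the supremum over rational points q of f q - C |p - q|. *)
rewrite (_ : _ @^-1` _ = \bigcup_q
    (fun p : measurableTypeR R * measurableTypeR R =>
      f (r q) - C * (`|p.1 - (r q).1 : R| + `|p.2 - (r q).2 : R|))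
      @^-1` `]a, +oo[); last first.
  apply/seteqP; split => [p|p [q _]] /=; rewrite !in_itv/= !andbT => ap.
    (* The 4 accounts for two coordinates and for the distance term entering twice, once through the
       Lipschitz bound and once through the subtracted penalty. *)
    have e0 : 0 < (f p - a) / (4 * (`|C| + 1)).
      by rewrite divr_gt0 ?subr_gt0// mulr_gt0// ltr_pwDr.
    have [q1 H1] := rat_dense p.1 e0; have [q2 H2] := rat_dense p.2 e0.
    exists (q1, q2) => //=; rewrite in_itv/= andbT.
    have := fC p (r (q1, q2)); rewrite ler_norml => /andP[_] /=.
    have : C * (`|p.1 - ratr q1| + `|p.2 - ratr q2|) < (f p - a) / 2.
      apply: (@le_lt_trans _ _
          ((`|C| + 1) * (`|p.1 - ratr q1| + `|p.2 - ratr q2|))).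
        rewrite ler_wpM2r ?addr_ge0//.
        by rewrite (le_trans (ler_norm _))// lerDl.
      have -> : (f p - a) / 2 = (`|C| + 1) *
          ((f p - a) / (4 * (`|C| + 1)) + (f p - a) / (4 * (`|C| + 1))).
        by field; have := normr_ge0 C; lra.
      by rewrite ltr_pM2l ?ltrD// ltr_pwDr.
    lra.
  by have := fC p (r q); rewrite ler_norml => /andP[H _]; lra.
apply: countable_bigcupT_measurable => // q.
have m (h : measurableTypeR R * measurableTypeR R -> R) (c : R) :
    measurable_fun setT h -> measurable_fun setT (fun p => `|h p - c|).
  move=> mh; apply: measurableT_comp; first exact: normr_measurable.
  by apply: measurable_funB => //; exact: measurable_cst.
rewrite -[X in measurable X]setTI.
suff : measurable_fun setT
  (fun p : measurableTypeR R * measurableTypeR R =>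
    f (r q) - C * (`|p.1 - (r q).1 : R| + `|p.2 - (r q).2 : R|)).
  by apply => //; exact: measurable_itv.
apply: measurable_funB; first exact: measurable_cst.
apply: measurable_funM; first exact: measurable_cst.
apply: measurable_funD; apply: m; first exact: measurable_fst.
exact: measurable_snd.
Qed.
End lipschitz_measurable.

(** * Pairing of bounded kernels with integrable boundary data *)

Section boundary_functional.
Context {R : realType}.
Implicit Types (x y : 'rV[R]_3) (i j : 'I_3) (b : bool) (k f : 'rV[R]_3 -> R).

Local Notation lebesgue2 :=
  (@lebesgue_measure R \x @lebesgue_measure R)%E.

Lemma measurable_unit_square : measurable (@unit_square R).
Proof. by apply: measurableX; exact: measurable_itv. Qed.

Lemma face_cube i b (st : R * R) : unit_square st -> cube (face i b st).
Proof.
move=> [] /=; rewrite !in_itv/= => s1 s2 j; rewrite mxE.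
case: unliftP => [k _|_]; first by case: ifP.
by case: b; rewrite ?lexx ler01.
Qed.

(** The unit square has finite measure and |c| <= 1 + c^2. *)
Lemma boundary_L2_integrable f : boundary_L2 f ->
  boundary_integrable f.
Proof.
move=> f2 i b; have [mf f2oo] := f2 i b.
have mD := measurable_unit_square.
have muD : (lebesgue2 (@unit_square R) < +oo)%E.
  rewrite product_measure1E; [|exact: measurable_itv..].
  have E : @lebesgue_measure R `[0, 1]%classic = 1%E.
    by rewrite lebesgue_measure_itv/= lte_fin ltr01 sube0.
  by rewrite [X in (X * _ < _)%E]E [X in (_ * X < _)%E]E mule1 ltry.
have i1 : lebesgue2.-integrable (@unit_square R) (fun=> 1%E).
  apply/integrableP; split; first exact: measurable_cst.
  by under eq_integral do rewrite abse1; rewrite integral_cst// mul1e.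
have i2 : lebesgue2.-integrable unit_square
    (fun st => (f (face i b st) ^+ 2)%:E).
  apply/integrableP; split; first exact/measurable_EFinP/measurable_funX.
  by under eq_integral do rewrite gee0_abs ?lee_fin ?sqr_ge0//.
apply: (le_integrable mD _ _ (integrableD mD i1 i2)).
  exact/measurable_EFinP.
move=> st _ /=; rewrite lee_fin; move: (f _) => c.
rewrite [leRHS]ger0_norm ?addr_ge0 ?sqr_ge0//.
by have := normr_ge0 c; rewrite -[c ^+ 2]real_normK ?num_real//; nra.
Qed.

(** A linear class of kernels whose products with integrable data stay integrable on each face, so
    that the pairing is linear on it. *)
Definition boundary_kernel k : Prop :=
  (forall i b, measurable_fun unit_square (fun st => k (face i b st))) /\
  exists B : R, forall y, cube y -> `|k y| <= B.

Lemma boundary_kernelB k1 k2 : boundary_kernel k1 -> boundary_kernel k2 ->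
  boundary_kernel (fun y => k1 y - k2 y).
Proof.
move=> [m1 [B1 H1]] [m2 [B2 H2]]; split.
  by move=> i b; exact: measurable_funB.
exists (B1 + B2) => y Yy.
by rewrite (le_trans (ler_normB _ _))// lerD// ?H1// H2.
Qed.

Lemma boundary_kernelZ (c : R) k : boundary_kernel k ->
  boundary_kernel (fun y => c * k y).
Proof.
move=> [m [B H]]; split.
  by move=> i b; apply: measurable_funM => //; exact: measurable_cst.
by exists (`|c| * B) => y Yy; rewrite normrM ler_wpM2l// H.
Qed.

Lemma boundary_kernelD k1 k2 : boundary_kernel k1 -> boundary_kernel k2 ->
  boundary_kernel (fun y => k1 y + k2 y).
Proof.
move=> [m1 [B1 H1]] [m2 [B2 H2]]; split.
  by move=> i b; exact: measurable_funD.
exists (B1 + B2) => y Yy.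
by rewrite (le_trans (ler_normD _ _))// lerD// ?H1// H2.
Qed.

Lemma boundary_kernel0 : boundary_kernel (fun=> 0).
Proof.
by split=> [i b|]; [exact: measurable_cst|exists 0 => y _; rewrite normr0].
Qed.

Lemma boundary_kernel_sum (I : Type) (s : seq I) (K : I -> 'rV[R]_3 -> R) :
  (forall l, boundary_kernel (K l)) ->
  boundary_kernel (fun y => \sum_(l <- s) K l y).
Proof.
move=> HK; elim: s => [|l s IH].
  by under eq_fun do rewrite big_nil; exact: boundary_kernel0.
by under eq_fun do rewrite big_cons; exact: boundary_kernelD.
Qed.

Variable f : 'rV[R]_3 -> R.
Hypothesis intf : boundary_integrable f.

Lemma boundary_kernel_integrable k : boundary_kernel k ->
  boundary_integrable (fun y => k y * f y).
Proof.
move=> [mk [B kB]] i b.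
apply: (bounded_pairing_integrable measurable_unit_square (intf i b) (mk i b)
  (B := B)).
by move=> st Dst; apply: kB; exact: face_cube.
Qed.

Definition pairing k : R := boundary_integral (fun y => k y * f y).

Lemma pairingB k1 k2 : boundary_kernel k1 -> boundary_kernel k2 ->
  pairing (fun y => k1 y - k2 y) = pairing k1 - pairing k2.
Proof.
move=> H1 H2; rewrite /pairing /boundary_integral -sumrB; apply: eq_bigr => i _.
rewrite -sumrB; apply: eq_bigr => b _.
rewrite -RintegralB; [|exact: measurable_unit_square|
  exact: boundary_kernel_integrable..].
by apply: eq_Rintegral => st _; rewrite mulrBl.
Qed.

Lemma pairingZ (c : R) k : boundary_kernel k ->
  pairing (fun y => c * k y) = c * pairing k.
Proof.
move=> H; rewrite /pairing /boundary_integral mulr_sumr; apply: eq_bigr => i _.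
rewrite mulr_sumr; apply: eq_bigr => b _.
rewrite -RintegralZl; [|exact: measurable_unit_square|
  exact: boundary_kernel_integrable].
by apply: eq_Rintegral => st _; rewrite mulrA.
Qed.

Lemma pairing_eq k1 k2 : (forall y, cube y -> k1 y = k2 y) ->
  pairing k1 = pairing k2.
Proof.
move=> k12; apply: eq_bigr => i _; apply: eq_bigr => b _.
apply: eq_Rintegral => st /set_mem Dst.
by rewrite k12//; exact: face_cube.
Qed.

Lemma pairingD k1 k2 : boundary_kernel k1 -> boundary_kernel k2 ->
  pairing (fun y => k1 y + k2 y) = pairing k1 + pairing k2.
Proof.
move=> H1 H2; have := pairingB H1 (boundary_kernelZ (-1) H2).
rewrite pairingZ// mulN1r opprK => <-.
by apply: pairing_eq => y _; rewrite mulN1r opprK.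
Qed.

Lemma pairing0 : pairing (fun=> 0) = 0.
Proof.
rewrite /pairing /boundary_integral big1// => i _; rewrite big1// => b _.
rewrite (@eq_Rintegral _ _ _ _ _ (fun=> 0)).
  by rewrite Rintegral_cst ?mul0r//; exact: measurable_unit_square.
by move=> st _; rewrite mul0r.
Qed.

Lemma pairing_sum (I : Type) (s : seq I) (K : I -> 'rV[R]_3 -> R) :
  (forall l, boundary_kernel (K l)) ->
  pairing (fun y => \sum_(l <- s) K l y) = \sum_(l <- s) pairing (K l).
Proof.
move=> HK; elim: s => [|l s IH].
  by rewrite big_nil; under eq_fun do rewrite big_nil; exact: pairing0.
rewrite big_cons -IH; under eq_fun do rewrite big_cons.
by rewrite pairingD//; exact: boundary_kernel_sum.
Qed.

(** [G] is the L^1 norm of the data. This turns kernel bounds uniform in y into bounds on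
    potentials. *)
Lemma pairing_le : exists2 G : R, 0 <= G &
  forall k (B : R), boundary_kernel k -> (forall y, cube y -> `|k y| <= B) ->
  `|pairing k| <= B * G.
Proof.
exists (\sum_(i < 3) \sum_(b : bool)
    \int[lebesgue2]_(st in unit_square) `|f (face i b st)|).
  do 2 apply: sumr_ge0 => ? _; exact: Rintegral_ge0.
move=> k B [mk _] kB; rewrite mulr_sumr (le_trans (ler_norm_sum _ _ _))//.
apply: ler_sum => i _; rewrite mulr_sumr (le_trans (ler_norm_sum _ _ _))//.
apply: ler_sum => b _.
apply: (bounded_pairing_le measurable_unit_square (intf i b) (mk i b)).
by move=> st Dst; apply: kB; exact: face_cube.
Qed.

End boundary_functional.

(** * The Poisson kernel of the remainder *)

Section poisson_kernel.
Context {R : realType}.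
Implicit Types (x y : 'rV[R]_3) (i j : 'I_3) (b : bool) (S : {set 'I_3})
  (u : @sym R) (v : 'I_3 -> @sym R).

Lemma norm_le_coord n (h : 'rV[R]_n) (c : R) : 0 <= c ->
  (forall l, `|h 0 l| <= c) -> `|h| <= c.
Proof.
move=> c0 hc; rewrite [leLHS]/Num.norm /= mx_normrE.
by apply/bigmax_leP; split=> // -[l' l] _ /=; rewrite (ord1 l').
Qed.

Lemma face_lipschitz i b (p q : R * R) :
  `|face i b p - face i b q| <= `|p.1 - q.1| + `|p.2 - q.2|.
Proof.
apply: norm_le_coord => [|j]; first by rewrite addr_ge0.
rewrite !mxE; case: unliftP => [k _|_]; last by rewrite subrr normr0 addr_ge0.
by case: ifP => _; rewrite ?lerDl ?lerDr.
Qed.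

(* Clamping extends Lipschitz functions from the unit square to the plane. *)
Definition clamp (s : R) : R := Num.min 1 (Num.max 0 s).

Lemma clamp01 s : 0 <= clamp s <= 1.
Proof. by rewrite /clamp le_min ler01 le_max lexx/= ge_min lexx. Qed.

Lemma clamp_id s : 0 <= s <= 1 -> clamp s = s.
Proof. by move=> /andP[s0 s1]; rewrite /clamp max_r// min_r. Qed.

Lemma clamp_lipschitz (s t : R) : `|clamp s - clamp t| <= `|s - t|.
Proof.
have H1 := ler_norm (s - t); have H2 := ler_norm (t - s).
rewrite distrC in H2; rewrite /clamp ler_norml.
have E : Num.min 1 0 = 0 :> R by rewrite min_r.
case: (leP 0 s) => ?; case: (leP 0 t) => ?;
  case: (leP 1 s) => ?; case: (leP 1 t) => ?;
  rewrite ?E; apply/andP; split; lra.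
Qed.

Lemma rsum_face_measurable S u x i b : decaying S u -> enlarged_cube x ->
  measurable_fun unit_square (fun st => rsum S u x (face i b st)).
Proof.
move=> dS Ex; have [C C0 HC] := rsum_lipschitz dS.
(* This agrees with the given function on the unit square and is Lipschitz on the whole plane, since
   clamping is 1-Lipschitz and keeps the argument in the cube. *)
pose g (st : measurableTypeR R * measurableTypeR R) : R :=
  rsum S u x (face i b (clamp st.1, clamp st.2)).
have near_face st : near_cube (face i b (clamp st.1, clamp st.2)).
  apply/cube_near_cube/face_cube; split => /=; rewrite in_itv/=; exact: clamp01.
apply: (@eq_measurable_fun _ _ _ _ _ g).
  move=> [s t] /set_mem[/=]; rewrite !in_itv/= => s01 t01.
  by rewrite /g /= !clamp_id.
apply: measurable_funTS; apply: (@lipschitz_measurable _ g C) => p q.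
have := HC _ _ _ _ Ex (near_face q) Ex (near_face p).
rewrite subrr normr0 add0r => /le_trans; apply; rewrite ler_wpM2l//.
apply: le_trans (face_lipschitz _ _ _ _) _ => /=.
by rewrite lerD// clamp_lipschitz.
Qed.

Lemma outward_normal_le1 y j : `|outward_normal y 0 j| <= 1.
Proof.
rewrite mxE; case: eqP => _; case: eqP => _ /=;
  by rewrite ?subrr ?subr0 ?sub0r ?normrN ?normr1 ?normr0.
Qed.

(** On a closed face the normal jumps at the edges, so it is written through the indicators of {0}
    and {1} composed with the coordinates. *)
Lemma outward_normal_measurable i b j :
  measurable_fun unit_square (fun st => outward_normal (@face R i b st) 0 j).
Proof.
have m1 (h : measurableTypeR R * measurableTypeR R -> R) (c : R) :
    measurable_fun unit_square h ->
    measurable_fun unit_square (fun st => (h st == c)%:R : R).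
  move=> mh; rewrite (_ : (fun _ => _) = (\1_[set c] : R -> R) \o h).
    by apply: (@measurableT_comp _ _ _ _ _ _ (\1_[set c] : R -> R)).
  apply/funext => st /=; rewrite indicE.
  rewrite (_ : (h st \in _) = (h st == c))//.
  by apply/idP/eqP => [/set_mem|->]; last exact: mem_set.
have mf : measurable_fun unit_square (fun st => @face R i b st 0 j).
  rewrite (_ : (fun _ => _) = fun st : measurableTypeR R * measurableTypeR R =>
    if unlift i j is Some k then if k == ord0 then st.1 else st.2 else b%:R).
    case: (unlift i j) => [k|]; last exact: measurable_cst.
    case: (k == ord0); apply: measurable_funTS.
      exact: measurable_fst.
    exact: measurable_snd.
  by apply/funext => st; rewrite mxE.
rewrite (_ : (fun _ => _) = fun st => (face i b st 0 j == 1)%:R -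
    (face i b st 0 j == 0)%:R); last by apply/funext => st; rewrite mxE.
by apply: measurable_funB; apply: m1.
Qed.

(** With [v j] equal to [dsym j Phi_sym] this is the normal derivative of the remainder. A free [v]
    also covers its x-derivatives, which apply [dsym i] to each [v j] and leave the toggled sets
    alone. *)
Definition normal_kernel v x y : R :=
  - \sum_j outward_normal y 0 j * rsum (toggle j [set: 'I_3]%SET) (v j) x y.

Definition decaying_family v : Prop :=
  forall j, decaying (toggle j [set: 'I_3]%SET) (v j).

Lemma decaying_family_dsym v i : decaying_family v ->
  decaying_family (fun j => dsym i (v j)).
Proof. by move=> dv j; exact: decaying_dsym. Qed.

Lemma normal_kernel_boundary_kernel v x : decaying_family v ->
  enlarged_cube x -> boundary_kernel (normal_kernel v x).
Proof.
move=> dv Ex.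
rewrite (_ : normal_kernel v x = fun y => -1 * \sum_j outward_normal y 0 j *
    rsum (toggle j [set: 'I_3]%SET) (v j) x y); last first.
  by apply/funext => y; rewrite mulN1r.
apply/boundary_kernelZ/boundary_kernel_sum => j; split.
  move=> i b; apply: measurable_funM; first exact: outward_normal_measurable.
  exact: rsum_face_measurable.
have [C C0 HC] := rsum_bound (dv j); exists C => y /cube_near_cube Yy.
rewrite normrM -[C]mul1r ler_pM//; first exact: outward_normal_le1.
exact: HC.
Qed.

Lemma normal_combination_le y (r B : 'I_3 -> R) : (forall j, `|r j| <= B j) ->
  `|- \sum_j outward_normal y 0 j * r j| <= \sum_j B j.
Proof.
move=> rB; rewrite normrN (le_trans (ler_norm_sum _ _ _))// ler_sum// => j _.
by rewrite normrM -[B j]mul1r ler_pM// outward_normal_le1.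
Qed.

Lemma normal_kernel_lipschitz v : decaying_family v ->
  exists C : R, forall x x' y, enlarged_cube x -> enlarged_cube x' -> cube y ->
    `|normal_kernel v x' y - normal_kernel v x y| <= C * `|x' - x|.
Proof.
move=> dv.
(* One Lipschitz constant is chosen per normal component, forgetting its sign. *)
have [C HC] := choice (fun j => let: ex_intro2 C _ H := rsum_lipschitz (dv j) in
  ex_intro (fun C : R => forall x y x' y', enlarged_cube x -> near_cube y ->
    enlarged_cube x' -> near_cube y' -> _ <= C * _) C H).
exists (\sum_j C j) => x x' y Ex Ex' /cube_near_cube Yy.
rewrite (_ : _ - _ = - \sum_j outward_normal y 0 j *
   (rsum (toggle j [set: 'I_3]%SET) (v j) x' y -
    rsum (toggle j [set: 'I_3]%SET) (v j) x y)); last first.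
  by under [in RHS]eq_bigr do rewrite mulrBr; rewrite sumrB opprB opprK addrC.
rewrite mulr_suml; apply: normal_combination_le => j.
by have := HC j _ _ _ _ Ex Yy Ex' Yy; rewrite subrr normr0 addr0.
Qed.

Lemma normal_kernel_taylor v : decaying_family v ->
  exists C : R, forall x x' y, enlarged_cube x -> enlarged_cube x' -> cube y ->
    `|normal_kernel v x' y - normal_kernel v x y -
      \sum_i (x' - x) 0 i * normal_kernel (fun j => dsym i (v j)) x y|
    <= C * `|x' - x| ^+ 2.
Proof.
move=> dv.
have H j : exists C : R, forall x x' y, enlarged_cube x -> enlarged_cube x' ->
   near_cube y ->
   `|rsum (toggle j [set: 'I_3]%SET) (v j) x' y -
    rsum (toggle j [set: 'I_3]%SET) (v j) x y -
    \sum_i (x' - x) 0 i * rsum (toggle j [set: 'I_3]%SET) (dsym i (v j)) x y|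
    <= C * `|x' - x| ^+ 2.
  have [C C0 HC] := rsum_taylor (dv j); exists C => x x' y Ex Ex' Yy.
  have := HC _ _ _ _ Ex Yy Ex' Yy; rewrite subrr normr0 addr0 /drsum.
  by under eq_bigr do rewrite [X in _ - X * _]mxE mul0r subr0.
have [C HC] := choice H.
exists (\sum_j C j) => x x' y Ex Ex' /cube_near_cube Yy.
rewrite (_ : _ - _ = - \sum_j outward_normal y 0 j *
   (rsum (toggle j [set: 'I_3]%SET) (v j) x' y -
    rsum (toggle j [set: 'I_3]%SET) (v j) x y -
    \sum_i (x' - x) 0 i * rsum (toggle j [set: 'I_3]%SET) (dsym i (v j)) x y)).
  by rewrite mulr_suml; apply: normal_combination_le => j; exact: HC.
(* The normal depends on y alone, so the sums over the x-direction i and the normal component j can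
   be exchanged. *)
under [in RHS]eq_bigr do rewrite !mulrBr.
rewrite !sumrB !opprB opprK addrC; congr (_ + _); last by rewrite addrC.
rewrite -sumrN.
under [in RHS]eq_bigr do rewrite mulr_sumr.
rewrite exchange_big; apply: eq_bigr => i _ /=.
rewrite /normal_kernel mulrN opprK mulr_sumr; apply: eq_bigr => j _.
by rewrite mulrCA.
Qed.

(** * Potentials of the normal kernels *)

Section potential.
Variable f : 'rV[R]_3 -> R.
Hypothesis intf : boundary_integrable f.

Definition potential v x : R := pairing f (normal_kernel v x).

Lemma potential_lipschitz v : decaying_family v ->
  lipschitz_in enlarged_cube (potential v).
Proof.
move=> dv; have [C HC] := normal_kernel_lipschitz dv.
have [G G0 HG] := pairing_le intf; exists (C * G) => x x' Ex Ex'.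
have k1 := normal_kernel_boundary_kernel dv Ex.
have k2 := normal_kernel_boundary_kernel dv Ex'.
rewrite /potential -pairingB// mulrAC; apply: HG.
  exact: boundary_kernelB.
by move=> y; exact: HC.
Qed.

Lemma potential_taylor v : decaying_family v ->
  taylor_in enlarged_cube (potential v)
    (fun i => potential (fun j => dsym i (v j))).
Proof.
move=> dv; have [C HC] := normal_kernel_taylor dv.
have [G G0 HG] := pairing_le intf; exists (C * G) => x x' Ex Ex'.
have k1 := normal_kernel_boundary_kernel dv Ex.
have k2 := normal_kernel_boundary_kernel dv Ex'.
have k3 i := normal_kernel_boundary_kernel (decaying_family_dsym i dv) Ex.
have k4 i := boundary_kernelZ ((x' - x) 0 i) (k3 i).
have k5 := boundary_kernelB k2 k1.
have k6 := boundary_kernel_sum (index_enum 'I_3) k4.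
(* The linear part is itself a pairing, so the whole Taylor error is the pairing of a single kernel,
   which [pairing_le] bounds. *)
have -> : \sum_i (x' - x) 0 i * potential (fun j => dsym i (v j)) x =
    pairing f (fun y => \sum_i (x' - x) 0 i *
      normal_kernel (fun j => dsym i (v j)) x y).
  by rewrite pairing_sum//; apply: eq_bigr => i _; rewrite pairingZ.
rewrite /potential -pairingB// -pairingB// mulrAC; apply: HG.
  exact: boundary_kernelB.
by move=> y; exact: HC.
Qed.

(** By linearity the Laplacian reaches the kernel, where each normal component involves a first
    derivative of [Phi], harmonic by [laplace_dsym_Phi]. *)
Lemma potential_laplace x : enlarged_cube x ->
  \sum_i potential (fun j => dsym i (dsym i (dsym j Phi_sym))) x = 0.
Proof.
move=> Ex.
have dv : decaying_family (fun j => dsym j Phi_sym).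
  by move=> j; apply: decaying_toggle; exact: decaying_Phi.
have k i := normal_kernel_boundary_kernel
  (decaying_family_dsym i (decaying_family_dsym i dv)) Ex.
rewrite /potential -pairing_sum// -[RHS](pairing0 f).
apply: pairing_eq => y /cube_near_cube Yy.
rewrite sumrN exchange_big big1 ?oppr0// => j _.
rewrite -mulr_sumr rsum_laplace ?mulr0//; last exact: laplace_dsym_Phi.
Qed.

End potential.

End poisson_kernel.

Theorem proposition3p7 (R : realType) :
  [/\ (* the series defining the remainder converges on the enlarged domain, for
         y in a neighborhood of the cube *)
      forall x y : 'rV[R]_3, enlarged_cube x -> cube y ->
        \forall z \near y, lattice_cvg (remainder_term x z),
      (* decomposition, away from the image points *)
      forall x y : 'rV[R]_3, enlarged_cube x -> cube y ->
        (forall n m, x != image_point y n m) ->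
        lattice_cvg (green_term x y) /\
        green x y = green27 x y + green_remainder x y,
      forall y : 'rV[R]_3, cube y ->
        harmonic_on enlarged_cube (fun x => green_remainder x y),
      (* existence of the normal derivatives *)
      forall x y : 'rV[R]_3, enlarged_cube x -> cube_boundary y ->
        derivable (green_remainder x) y (outward_normal y)
    & forall f : 'rV[R]_3 -> R, boundary_L2 f ->
        (forall x, enlarged_cube x ->
           boundary_integrable (poisson_integrand f x)) /\
        harmonic_on enlarged_cube (remainder_potential f)].
Proof.
split.
- move=> x y Ex /cube_near_cube/near_cube_open; apply: filterS => z Yz.
  rewrite /lattice_cvg.
  rewrite (_ : remainder_term x z = rterm [set: 'I_3]%SET Phi_sym x z).
    exact: (rterm_converges (@decaying_Phi R)).
  by apply/funext => n; exact: remainder_termE.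
- by move=> x y Ex Yy _; exact: green_decomposition.
- by move=> y /cube_near_cube; exact: green_remainder_harmonic.
- move=> x y Ex [/cube_near_cube Yy _].
  by have [] := green_remainder_derive (outward_normal y) Ex Yy.
- move=> f /boundary_L2_integrable intf.
  pose v j : @sym R := dsym j Phi_sym.
  have dv : decaying_family v.
    by move=> j; apply: decaying_toggle; exact: decaying_Phi.
  (* The two integrands are identified only for x in the enlarged cube and y in the cube; this
     suffices on the faces and for [taylor_eq_in]. *)
  have kE x y : enlarged_cube x -> cube y ->
      poisson_integrand f x y = normal_kernel v x y * f y.
    move=> Ex /cube_near_cube Yy; rewrite /poisson_integrand; congr (_ * _).
    by have [_ ->] := green_remainder_derive (outward_normal y) Ex Yy.
  split=> [x Ex i b|].
    have := boundary_kernel_integrable intf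
      (normal_kernel_boundary_kernel dv Ex) i b.
    apply: eq_integrable; first exact: measurable_unit_square.
    by move=> st /set_mem Dst; rewrite kE//; exact: face_cube.
  have oE := @enlarged_cube_open R.
  apply: (@harmonic_of_taylor _ _ _
    (fun i => potential f (fun j => dsym i (v j)))
    (fun i j => potential f (fun l => dsym j (dsym i (v l)))) oE).
  + apply: taylor_eq_in (potential_taylor intf dv) => x Ex.
    apply: eq_bigr => i _; apply: eq_bigr => b _; apply: eq_Rintegral => st.
    by move=> /set_mem Dst; rewrite kE//; exact: face_cube.
  + by move=> i; apply: potential_lipschitz => //; exact: decaying_family_dsym.
  + by move=> i; apply: potential_taylor => //; exact: decaying_family_dsym.
  + by move=> i j; apply: potential_lipschitz => //;
      do 2 apply: decaying_family_dsym.
  + by move=> x; exact: potential_laplace.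
Qed.
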